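(* For every $p=p(n)\leq\frac{1.02\ln n}{n}$, with high probability the random graph $G\sim G(n,p)$ contains $\lfloor\delta(G)/2\rfloor$ pairwise edge-disjoint Hamilton cycles.
   Context: $G(n,p)$ is the binomial random graph on vertex set $[n]$ in which each pair is an edge independently with probability $p$; ''with high probability'' means with probability tending to $1$ as $n\to\infty$. $\delta(G)$ denotes the minimum degree of $G$. *)

(* Defs.v *)
From mathcomp Require Import all_boot all_order all_algebra.
From mathcomp Require Import all_classical all_reals all_analysis.

Set Implicit Arguments.
Unset Strict Implicit.
Unset Printing Implicit Defensive.

Import Order.TTheory GRing.Theory Num.Theory.
Local Open Scope ring_scope.

(* A finite simple graph on the vertex type T is represented by its edge set
   E : {set {set T}}, with E \subset vpairs T. *)
Section Graphs.
Variable T : finType.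

Definition vpairs : {set {set T}} := [set e : {set T} | #|e| == 2%N].

Definition degree (E : {set {set T}}) (v : T) : nat := #|[set e in E | v \in e]|.

(* Degrees in a simple graph are < #|T|, so the neutral value #|T| of the
   iterated minimum only shows up when T is empty (and is then 0). *)
Definition min_degree (E : {set {set T}}) : nat :=
  \big[minn/#|T|]_(v : T) degree E v.

Definition cycle_edges (s : seq T) : {set {set T}} :=
  [set [set x; next s x] | x in s].

(* A duplicate-free #|T|-tuple lists every vertex exactly once; a cycle has
   at least 3 vertices. *)
Definition hamilton_cycle (H : {set {set T}}) : bool :=
  (2 < #|T|)%N &&
  [exists s : #|T|.-tuple T, uniq s && (H == cycle_edges s)].

Definition edge_disjoint_hamilton_cycles (E : {set {set T}}) (k : nat) : bool :=
  [exists C : {ffun 'I_k -> {set {set T}}},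
    [forall i, hamilton_cycle (C i) && (C i \subset E)] &&
    [forall i, forall j, (i != j) ==> [disjoint C i & C j]]].

End Graphs.

Definition gnp_weight (R : realType) (n : nat) (p : R)
    (E : {set {set 'I_n}}) : R :=
  \prod_(e in vpairs 'I_n) (if e \in E then p else 1 - p).

Definition gnp_prob (R : realType) (n : nat) (p : R)
    (A : pred {set {set 'I_n}}) : R :=
  \sum_(E : {set {set 'I_n}} | (E \subset vpairs 'I_n) && A E) gnp_weight p E.

(* Main.v *)
Require Import Defs.
From mathcomp Require Import all_boot all_order all_algebra.
From mathcomp Require Import all_classical all_reals all_analysis.
From mathcomp Require Import zify ring lra.
From mathcomp Require Import finset fintype bigop.

Set Implicit Arguments.
Unset Strict Implicit.
Unset Printing Implicit Defensive.

Import Order.TTheory GRing.Theory Num.Theory.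
Import numFieldNormedType.Exports.

(** Write [L = ln n].  If [p <= 0.95 L / n], a second moment computation gives an
    isolated vertex, so no cycle is needed.  Otherwise [L / n] is the order of [p],
    the second moment gives a vertex of degree at most [0.005 L], and first moment
    bounds show that typically
    - vertices of degree at most [0.01 L] are pairwise at distance more than 4;
    - small sets span few edges, and two linear sets have many edges between them;
    - for disjoint subgraphs [G], [H] with at most [0.0027 n L] edges in total, if [G]
      has at least [n^2 / 32] boosters (pairs whose addition lengthens a longest path of
      [G] or closes a Hamilton cycle), then one of them is an edge outside [H].
    Remove Hamilton cycles one at a time.  When their union [H] still leaves minimum
    degree 2, the residual graph contains a sparse connected 2-expander: keep
    [L / 10000] edges at each vertex, two at the low-degree ones, and add a greedily
    chosen set of [O(n)] edges hitting every cut between linear sets.  By Posa rotations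
    such a graph has at least [n^2 / 32] boosters, so boosters can be added from the
    residual graph until it is Hamiltonian. *)

(** * Rotations and boosters *)

(** The obstacle is dependence. Once a cycle has been removed, the residual graph depends on all of
    [E], and no fresh randomness is left for the next cycle. All the randomness is therefore spent
    once, on properties of [E] that hold uniformly over every removed [H] and every partial graph
    [G]; the rest is deterministic.

    The price is a union bound over all pairs [G], [H]. Its entropy must stay below the exponent,
    about [p * n ^ 2 / 32], of the probability that all boosters are absent. So [#|G| + #|H|] has to
    be a small fraction of [n L]. This is why boosters are sought for a sparse subgraph and not for
    the whole residual graph, and why the minimum degree has to be a small fraction of [L]: the
    removed cycles then use few edges.

    The gap between the degree bounds [0.005 L] and [0.01 L] lets one fixed set of low-degree
    vertices of [E] serve for all residual graphs: any other vertex keeps many edges whichever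
    cycles are removed. *)

Section Adjacency.
Variable T : finType.
Implicit Types (G : {set {set T}}) (U : {set T}) (s p q : seq T).

Definition adj G x y := (x != y) && ([set x; y] \in G).

Definition nbhd G U := [set y | (y \notin U) && [exists x in U, adj G x y]].

Lemma adj_sym G x y : adj G x y = adj G y x.
Proof. by rewrite /adj eq_sym setUC. Qed.

Lemma adj_subset G1 G2 x y : G1 \subset G2 -> adj G1 x y -> adj G2 x y.
Proof. by move=> sG /andP[xy /(subsetP sG) h]; apply/andP. Qed.

Lemma nbhdP G U y :
  reflect (y \notin U /\ exists2 x, x \in U & adj G x y) (y \in nbhd G U).
Proof.
rewrite inE; apply: (iffP andP) => [[yU /existsP[x /andP[xU xy]]]|[yU [x xU xy]]].
  by split=> //; exists x.
by split=> //; apply/existsP; exists x; rewrite xU.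
Qed.

Lemma nbhd_subset G1 G2 U : G1 \subset G2 -> nbhd G1 U \subset nbhd G2 U.
Proof.
move=> sG; apply/subsetP=> y /nbhdP[yU [x xU xy]]; apply/nbhdP; split=> //.
by exists x => //; apply: adj_subset xy.
Qed.

Lemma eq_set2 (x y z w : T) :
  [set x; y] = [set z; w] -> (x = z /\ y = w) \/ (x = w /\ y = z).
Proof.
move=> e; have : x \in [set z; w] by rewrite -e set21.
have : y \in [set z; w] by rewrite -e set22.
have : z \in [set x; y] by rewrite e set21.
have : w \in [set x; y] by rewrite e set22.
by rewrite !inE => /orP[]/eqP ? /orP[]/eqP ? /orP[]/eqP ? /orP[]/eqP ?; subst; auto.
Qed.

Lemma sum_degree G : \sum_(v : T) degree G v = \sum_(e in G) #|e|.
Proof.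
rewrite /degree; under eq_bigr do rewrite -sum1_card.
under [RHS]eq_bigr do rewrite -sum1_card.
rewrite (exchange_big_dep (fun e => e \in G)) /=; last by move=> v e _; rewrite inE => /andP[].
apply: eq_bigr => e eG; apply: eq_bigl => v.
by rewrite inE eG.
Qed.

Definition gpath G s := uniq s && sorted (adj G) s.

Lemma gpath_size G s : gpath G s -> size s <= #|T|.
Proof. by case/andP=> /card_uniqP<- _; apply: max_card. Qed.

Lemma gpath_subset G1 G2 s : G1 \subset G2 -> gpath G1 s -> gpath G2 s.
Proof.
move=> sG /andP[us ss]; rewrite /gpath us /=.
by apply: sub_sorted ss => x y; apply: adj_subset.
Qed.

Lemma sorted_adj_rev G s : sorted (adj G) (rev s) = sorted (adj G) s.
Proof. by rewrite rev_sorted; apply: eq_sorted => x y; rewrite adj_sym. Qed.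

Lemma gpath_rev G s : gpath G (rev s) = gpath G s.
Proof. by rewrite /gpath rev_uniq sorted_adj_rev. Qed.

Fixpoint pedges s : seq {set T} :=
  if s is x :: s' then (if s' is y :: _ then [set x; y] :: pedges s' else [::])
  else [::].

Lemma pedges_cons2 x y s : pedges (x :: y :: s) = [set x; y] :: pedges (y :: s).
Proof. by []. Qed.

Lemma pedges_cat p x q : pedges (p ++ x :: q) = pedges (rcons p x) ++ pedges (x :: q).
Proof.
elim: p => [|a [|b p] IH] //.
have -> : pedges ([:: a, b & p] ++ x :: q) = [set a; b] :: pedges ((b :: p) ++ x :: q) by [].
by rewrite IH.
Qed.

Lemma pedges_rcons2 s x y : pedges (rcons (rcons s x) y) = rcons (pedges (rcons s x)) [set x; y].
Proof. by rewrite -[rcons (rcons s x) y]cats1 cat_rcons pedges_cat cats1. Qed.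

Lemma pedges_rev s : pedges (rev s) = rev (pedges s).
Proof.
elim: s => [|x [|y s] IH] //; rewrite pedges_cons2 (rev_cons [set x; y]) -IH.
by rewrite !rev_cons pedges_rcons2 setUC.
Qed.

Lemma pedges_mem s z w : [set z; w] \in pedges s -> z \in s.
Proof.
elim: s => [|x [|y s] IH] //; rewrite pedges_cons2 inE => /orP[/eqP/eq_set2 h|/IH].
  by rewrite !inE; case: h => [[-> _]|[-> _]]; rewrite eqxx ?orbT.
by rewrite !inE => ->; rewrite orbT.
Qed.

Lemma pedges_nth a s e : e \in pedges s ->
  exists i, i.+1 < size s /\ e = [set nth a s i; nth a s i.+1].
Proof.
elim: s => [|x [|y s] IH] //; rewrite pedges_cons2 inE => /orP[/eqP->|/IH[i [lti ->]]].
  by exists 0.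
by exists i.+1; rewrite ltnS.
Qed.

Lemma size_pedges x s : size (pedges (x :: s)) = size s.
Proof. by elim: s x => [|y s IH] x //; rewrite pedges_cons2 /= -(IH y). Qed.

Lemma uniq_pedges s : uniq s -> uniq (pedges s).
Proof.
elim: s => [|x [|y s] IH] // /andP[xs us]; rewrite pedges_cons2 cons_uniq IH // andbT.
by apply/negP => /pedges_mem; apply/negP.
Qed.

Lemma pedges_path G x s : path (adj G) x s -> {subset pedges (x :: s) <= G}.
Proof.
elim: s x => [|y s IH] x //= /andP[/andP[_ xy] ps] e; rewrite inE => /orP[/eqP->//|].
exact: IH.
Qed.

(* A Posa rotation fixes the first vertex and pivots at [x]. *)
Inductive reach G s0 : seq T -> Prop :=
| reach_refl : reach G s0 s0
| reach_rot p x y q : reach G s0 (p ++ x :: y :: q) -> adj G (last y q) x ->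
    reach G s0 (p ++ x :: rev (y :: q)).

Lemma rev_lastE y q : exists r, rev (y :: q) = last y q :: r.
Proof. by exists (rev (belast y q)); rewrite -rev_rcons -lastI. Qed.

Lemma last_rot a p x y q : last a (p ++ x :: rev (y :: q)) = y.
Proof. by rewrite last_cat /= rev_cons last_rcons. Qed.

Lemma reach_gpath G s0 s : gpath G s0 -> reach G s0 s ->
  [/\ gpath G s, size s = size s0 & forall a, head a s = head a s0].
Proof.
move=> g0; elim=> // {}s x y q _ [gs ss hs] bx; split; last 2 first.
- by rewrite -ss !size_cat /= size_rev.
- by move=> a; rewrite -hs; case: (s).
move: gs => /andP[us os]; apply/andP; split.
  rewrite -(@perm_uniq _ (s ++ x :: y :: q)) // perm_cat2l perm_cons.
  by rewrite perm_sym perm_rev.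
move: os; rewrite !sorted_cat_cons => /andP[-> /=].
case/andP=> _ yq; have: sorted (adj G) (rev (y :: q)) by rewrite sorted_adj_rev.
by have [r ->] := rev_lastE y q; rewrite /= adj_sym bx.
Qed.

Definition longest G s := gpath G s /\ forall s', gpath G s' -> size s' <= size s.

Lemma longest_rev G s : longest G s -> longest G (rev s).
Proof. by move=> [gs ms]; split; [rewrite gpath_rev | rewrite size_rev]. Qed.

Lemma reach_longest G s0 s : longest G s0 -> reach G s0 s -> longest G s.
Proof.
move=> [g0 m0] rs; have [gs ss _] := reach_gpath g0 rs.
by split=> // s' /m0; rewrite ss.
Qed.

Lemma exists_longest G (v : T) : exists s, longest G s /\ 0 < size s.
Proof.
have ex : exists k, `[< exists s, gpath G s /\ size s = k >].
  by exists 0; apply/asboolP; exists [::].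
have ub k : `[< exists s, gpath G s /\ size s = k >] -> k <= #|T|.
  by move=> /asboolP[s [/gpath_size gs <-]].
case: (ex_maxnP ex ub) => k /asboolP[s [gs ks]] mk; exists s; split.
  by split=> // s' gs'; rewrite ks; apply: mk; apply/asboolP; exists s'.
by rewrite ks; apply: mk; apply/asboolP; exists [:: v].
Qed.

Definition endpoints G a r : {set T} :=
  [set v | `[< exists2 s, reach G (a :: r) s & last a s = v >]].

Lemma endpointsP G a r v :
  reflect (exists2 s, reach G (a :: r) s & last a s = v) (v \in endpoints G a r).
Proof. by rewrite inE; apply: asboolP. Qed.

Definition path_nbrs s U : {set T} := [set z | [exists w in U, [set z; w] \in pedges s]].

(* The path edges at a vertex that is neither an endpoint nor a path neighbour of
   one survive all rotations. *)
Lemma reach_pedges G a r s z w : longest G (a :: r) -> reach G (a :: r) s ->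
  z \notin endpoints G a r -> z \notin path_nbrs (a :: r) (endpoints G a r) ->
  ([set z; w] \in pedges s) = ([set z; w] \in pedges (a :: r)).
Proof.
move=> lr rs zE zN; elim: rs w => // p x y q rs IH bx w.
have yE : y \in endpoints G a r.
  by apply/endpointsP; exists (p ++ x :: rev (y :: q)); [exact: reach_rot | exact: last_rot].
have bE : last y q \in endpoints G a r.
  by apply/endpointsP; exists (p ++ x :: y :: q) => //; rewrite last_cat.
have zy : z != y by apply: contraNneq zE => ->.
have zb : z != last y q by apply: contraNneq zE => ->.
have zx : z != x.
  apply: contraNneq zN => zx; rewrite inE; apply/existsP; exists y; rewrite yE /=.
  by rewrite -IH zx pedges_cat pedges_cons2 mem_cat !inE eqxx orbT.
have ne u : z != u -> ([set z; w] == [set x; u]) = false.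
  move=> zu; apply/eqP => /eq_set2[[zx' _]|[zu' _]].
    by rewrite zx' eqxx in zx.
  by rewrite zu' eqxx in zu.
have [r' E] := rev_lastE y q.
rewrite -IH !pedges_cat !mem_cat (pedges_cons2 x y) inE ne // orFb.
by rewrite E pedges_cons2 inE ne // orFb -E pedges_rev mem_rev.
Qed.

(** Let [z] be adjacent to the end [b] of a rotated path [s]. If [z] were off [s], then [s] could be
    extended. Otherwise rotating at [z] makes its successor [y] an endpoint. If [z] were not a path
    neighbour of an endpoint, the edge [zy] of [s] would by [reach_pedges] belong to the original
    path, which makes [z] a path neighbour of [y] after all. *)
Lemma nbhd_endpoints G a r : longest G (a :: r) ->
  nbhd G (endpoints G a r) \subset path_nbrs (a :: r) (endpoints G a r).
Proof.
move=> lr; apply/subsetP => z /nbhdP[zE [b /endpointsP[s rs bs] bz]].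
apply/negPn/negP => zN.
have [/andP[us os] ms] := reach_longest lr rs.
have zs : z \in s.
  apply/negPn/negP => zs; have := ms (rcons s z); rewrite size_rcons ltnn.
  suff -> : gpath G (rcons s z) by move=> /(_ isT).
  rewrite /gpath rcons_uniq zs us /=.
  case: (s) bs os => [|c s'] /= bs os; first by [].
  by rewrite rcons_path os bs.
case/splitPr: zs rs us os ms bs => p q rs us os ms bs.
(* If [z] were last on [s], it would equal [b], and no vertex is adjacent to itself. *)
case: q => [|y q] in rs us os ms bs *.
  by rewrite last_cat /= in bs; rewrite -bs /adj eqxx in bz.
have bz' : adj G (last y q) z by move: bs; rewrite last_cat /= => ->.
have rs' := reach_rot rs bz'.
have yE : y \in endpoints G a r by apply/endpointsP; eexists; [exact: rs' | exact: last_rot].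
case/negP: (zN); rewrite inE; apply/existsP; exists y; rewrite yE andTb.
rewrite -(@reach_pedges G a r (p ++ z :: y :: q)) //.
by rewrite pedges_cat pedges_cons2 mem_cat inE eqxx orbT.
Qed.

(** A vertex has at most a predecessor and a successor. The last vertex lies in [U] and has no
    successor, whence the strict inequality. *)
Lemma card_path_nbrs a r (U : {set T}) : uniq (a :: r) -> last a r \in U ->
  #|path_nbrs (a :: r) U| < 2 * #|U|.
Proof.
move=> us lU; set s := a :: r.
pose succ w := nth a s (index w s).+1; pose pre w := nth a s (index w s).-1.
have sub : path_nbrs s U \subset (succ @: (U :\ last a r)) :|: (pre @: U).
  apply/subsetP => z; rewrite inE => /existsP[w /andP[wU /(pedges_nth a)[i [lti]]]].
  have li := ltnW lti.
  rewrite inE; case/eq_set2 => [[zi wi]|[zi wi]]; apply/orP; [right|left]; apply/imsetP.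
    by exists w => //; rewrite /pre wi index_uniq.
  exists w; last by rewrite /succ wi index_uniq.
  rewrite !inE wU andbT; apply/eqP => wl.
  have : index w s = size r by rewrite wl (last_nth a) index_uniq.
  by rewrite wi index_uniq // => ir; move: lti; rewrite ir ltnn.
apply: leq_ltn_trans (subset_leq_card sub) _.
apply: leq_ltn_trans (leq_card_setU _ _) _.
have h1 := leq_imset_card succ (U :\ last a r).
have h2 := leq_imset_card pre U.
have := cardsD1 (last a r) U; rewrite lU => h3.
by rewrite mul2n -addnn; lia.
Qed.

Lemma posa G a r : longest G (a :: r) ->
  #|nbhd G (endpoints G a r)| < 2 * #|endpoints G a r|.
Proof.
move=> lr; apply: leq_ltn_trans (subset_leq_card (nbhd_endpoints lr)) _.
case: (lr) => [/andP[us _] _]; apply: card_path_nbrs => //.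
by apply/endpointsP; exists (a :: r); [exact: reach_refl|].
Qed.

(** Pairs that are already edges of [G] are not excluded; the union bound over [G] and [H] subtracts
    them. *)
Definition boosters G : {set {set T}} :=
  [set e in vpairs T | `[< exists x r, longest G (x :: r) /\ e = [set x; last x r] >]].

Definition expander G := forall U, 4 * #|U| <= #|T| -> 2 * #|U| <= #|nbhd G U|.

Definition connected_graph G := forall U, U != set0 -> U != setT -> nbhd G U != set0.

Definition hamiltonian G := exists2 H, hamilton_cycle H & H \subset G.

Lemma expander_subset G1 G2 : G1 \subset G2 -> expander G1 -> expander G2.
Proof.
move=> sG e1 U /e1 h; apply: leq_trans h _.
exact: subset_leq_card (nbhd_subset _ sG).
Qed.

Lemma connected_subset G1 G2 : G1 \subset G2 -> connected_graph G1 -> connected_graph G2.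
Proof.
move=> sG c1 U U0 UT; apply: contraNneq (c1 U U0 UT) => h.
by rewrite -subset0 -h nbhd_subset.
Qed.

Lemma endpoints_boosters G a r b : longest G (a :: r) -> 0 < size r ->
  b \in endpoints G a r -> [set a; b] \in boosters G.
Proof.
move=> lr r0 /endpointsP[s rs bs]; have ls := reach_longest lr rs.
have [gs ss hs] := reach_gpath (proj1 lr) rs.
case: s rs bs ls gs ss hs => [|c s] //= rs bs ls /andP[us _] [ss] /(_ a) /= ca; subst c.
rewrite inE; apply/andP; split; last by apply/asboolP; exists a, s; rewrite bs.
rewrite inE cards2 eqSS eqb1; apply/eqP => ab.
case: s ss bs us {rs ls} => [|y s] /=; first by move=> r0'; rewrite -r0' in r0.
by move=> _ bs /andP[/negP h _]; apply: h; rewrite ab -bs mem_last.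
Qed.

Lemma card_endpoints G a r : expander G -> longest G (a :: r) ->
  #|T| < 4 * #|endpoints G a r|.
Proof.
move=> ex lr; rewrite ltnNge; apply/negP => /ex.
by apply/negP; rewrite -ltnNge; apply: posa.
Qed.

Lemma expander_longest_size G a r : 3 < #|T| -> expander G -> longest G (a :: r) -> 0 < size r.
Proof.
move=> T3 ex [_ mr].
have : 2 * #|[set a]| <= #|nbhd G [set a]| by apply: ex; rewrite cards1.
rewrite cards1 => h; have : 0 < #|nbhd G [set a]| by apply: leq_trans h.
case/card_gt0P => y /nbhdP[_ [x]]; rewrite inE => /eqP-> ay.
have := mr [:: a; y]; rewrite /gpath /= ay; case/andP: ay => ny _.
by rewrite inE ny => /(_ isT).
Qed.

Lemma leq_degree (B : {set {set T}}) (b : T) (Y : {set T}) :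
  (forall c, c \in Y -> [set b; c] \in B) -> b \notin Y -> #|Y| <= degree B b.
Proof.
move=> h bY; rewrite -(@card_in_imset _ _ (fun c => [set b; c])); last first.
  by move=> c c' cY c'Y /eq_set2[[]//|[_ cb]]; rewrite -cb cY in bY.
apply/subset_leq_card/subsetP => e /imsetP[c cY ->].
by rewrite inE h // set21.
Qed.

(** Rotations with one end fixed reach more than [n / 4] endpoints [b]. With [b] fixed instead,
    rotations reach more than [n / 4] partners of [b]. Each pair is counted at most twice, so there
    are at least [n ^ 2 / 32] boosters. *)
Lemma card_boosters G : 3 < #|T| -> expander G -> #|T| ^ 2 <= 32 * #|boosters G|.
Proof.
move=> T3 ex; have /card_gt0P[v _] : 0 < #|T| by apply: leq_trans T3.
have [[|a r] [lr //= _]] := exists_longest G v.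
have hdeg b : b \in endpoints G a r -> #|T| < 4 * degree (boosters G) b.
  case/endpointsP => s rs bs.
  (* Reversing the rotated path turns its moving end [b] into the fixed one. *)
  have ls := longest_rev (reach_longest lr rs).
  have [gs ss hs] := reach_gpath (proj1 lr) rs.
  have [r' E] : exists r', rev s = b :: r'.
    by case: s {rs ls gs hs} ss bs => [|c s] //= _ <-; apply: rev_lastE.
  rewrite E in ls; have r0 := expander_longest_size T3 ex ls.
  apply: leq_trans (card_endpoints ex ls) _; rewrite leq_mul2l /=.
  apply: leq_degree => [c|]; first exact: endpoints_boosters.
  by apply/negP => /(endpoints_boosters ls r0); rewrite inE setUid inE cards1.
have h1 := card_endpoints ex lr.
have h2 : \sum_(v : T) degree (boosters G) v = 2 * #|boosters G|.
  rewrite sum_degree mulnC -sum_nat_const; apply: eq_bigr => e.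
  by rewrite inE inE => /andP[/eqP].
have h3 : #|endpoints G a r| * #|T|.+1 <= 4 * \sum_(v : T) degree (boosters G) v.
  rewrite -sum_nat_const big_distrr /= [X in _ <= X](bigID (mem (endpoints G a r))) /=.
  by apply: leq_trans (leq_addr _ _); apply: leq_sum => b /hdeg.
have h4 : #|T| * #|T| <= (4 * #|endpoints G a r|) * #|T|.+1.
  by apply: leq_mul => //; apply: ltnW.
rewrite h2 in h3; rewrite -mulnn; apply: leq_trans h4 _.
by have := leq_mul (leqnn 4) h3; rewrite !mulnA.
Qed.

(** The booster closes a longest path into a cycle. If the cycle is not spanning, connectivity gives
    a vertex [v] outside it adjacent to some [u] on it; opening the cycle at [u] and prepending [v]
    gives a path with one more vertex. *)
Lemma booster_step G e : 2 < #|T| -> connected_graph G -> e \in boosters G ->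
  hamiltonian (e |: G) \/
  exists2 s, gpath (e |: G) s & forall s', gpath G s' -> size s' < size s.
Proof.
move=> T2 cG; rewrite inE => /andP[ev /asboolP[x [r [[gr mr] eE]]]].
have xl : x != last x r by move: ev; rewrite inE eE cards2 eqSS eqb1.
have sG : G \subset e |: G by apply: subsetUr.
case/andP: (gr) => us _.
have cyc : cycle (adj (e |: G)) (x :: r).
  rewrite /= rcons_path; case/andP: (gpath_subset sG gr) => _ /= -> /=.
  by rewrite /adj eq_sym xl setUC -eE setU11.
have [rT|rT] := eqVneq (size (x :: r)) #|T|.
  left; exists (cycle_edges (x :: r)).
    rewrite /hamilton_cycle T2; apply/existsP.
    have tP : size (x :: r) == #|T| by apply/eqP.
    by exists (Tuple tP); rewrite us eqxx.
  apply/subsetP => f /imsetP[y yr ->].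
  by have /andP[] := next_cycle cyc yr.
right; have : nbhd G [set y in x :: r] != set0.
  apply: cG; first by apply/set0Pn; exists x; rewrite !inE eqxx.
  apply: contra_neq rT => h; rewrite -(card_uniqP us) -cardsT -h.
  by apply: eq_card => z; rewrite !inE.
case/set0Pn => v /nbhdP[]; rewrite inE => vr [u]; rewrite inE => ur uv.
have [i s' E] := rot_to ur.
exists (v :: u :: s').
  apply/andP; split.
    by rewrite cons_uniq -E rot_uniq mem_rot vr.
  rewrite /= adj_sym (adj_subset sG uv) /=.
  by have := cyc; rewrite -(rot_cycle i) E /= rcons_path => /andP[].
by move=> s /mr; rewrite /= -[(size s').+1]/(size (u :: s')) -E size_rot ltnS.
Qed.

(* Each added booster lengthens a longest path, so [#|T|.+1] steps suffice. *)
Lemma hamiltonian_boost G0 (F : {set {set T}}) : 2 < #|T| -> connected_graph G0 -> G0 \subset F ->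
  (forall G, G0 \subset G -> G \subset F -> #|G| <= #|G0| + #|T| ->
     exists2 e, e \in boosters G & e \in F) ->
  hamiltonian F.
Proof.
move=> T2 c0 s0 hb.
have : forall j, j <= #|T|.+1 -> hamiltonian F \/ exists2 G : {set {set T}},
    [/\ G0 \subset G, G \subset F & #|G| <= #|G0| + j] &
    exists2 s, gpath G s & j <= size s.
  elim=> [_|j IH jT].
    by right; exists G0; [rewrite addn0 | exists [::]].
  case: (IH (ltnW jT)) => [|[G [sG GF cG] [s gs js]]]; first by left.
  have [|e eB eF] := hb G sG GF; first by apply: leq_trans cG _; rewrite leq_add2l.
  have eGF : e |: G \subset F by rewrite subUset sub1set eF.
  have [[H hH sH]|[s' gs' ls']] := booster_step T2 (connected_subset sG c0) eB.
    by left; exists H => //; apply: subset_trans eGF.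
  right; exists (e |: G); last by exists s' => //; apply: leq_ltn_trans (ls' _ gs).
  split=> //; first by apply: subset_trans (subsetUr _ _).
  by rewrite cardsU1 addnS -add1n; apply: leq_add cG; apply: leq_b1.
case/(_ _ (leqnn _)) => // [[G _ [s /gpath_size]]].
by move=> h1 h2; have := leq_trans h2 h1; rewrite ltnn.
Qed.

End Adjacency.

(** * Packing Hamilton cycles in a pseudorandom graph *)

Section FiniteSets.
Variables I J : finType.

Lemma leq_card_bigcup (A : {set I}) (F : I -> {set J}) :
  #|\bigcup_(i in A) F i| <= \sum_(i in A) #|F i|.
Proof.
elim/big_rec2: _ => [|i m U _ h]; first by rewrite cards0.
by apply: leq_trans (leq_card_setU _ _) _; rewrite leq_add2l.
Qed.

Lemma card_bigcup_disjoint (A : {set I}) (F : I -> {set J}) :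
  {in A &, forall i j, i != j -> [disjoint F i & F j]} ->
  #|\bigcup_(i in A) F i| = \sum_(i in A) #|F i|.
Proof.
move=> dF; pose F' i := if i \in A then F i else set0.
have dF' i j : i != j -> [disjoint F' i & F' j].
  rewrite /F'; case: ifP => iA; case: ifP => jA ij; rewrite ?disjoints_subset ?sub0set //.
    by rewrite -disjoints_subset dF.
  by rewrite setC0 subsetT.
have E1 : \bigcup_(i in A) F i = \bigcup_i F' i.
  by rewrite big_mkcond; apply: eq_bigr => i _; rewrite /F'; case: ifP.
rewrite E1 -sum1_card partition_disjoint_bigcup // [RHS]big_mkcond /=.
by apply: eq_bigr => i _; rewrite sum1_card /F'; case: ifP; rewrite ?cards0.
Qed.

Lemma averaging (F : J -> {set I}) (E : {set I}) (U : {set J}) (M w : nat) :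
  #|E| <= M -> 0 < w -> U != set0 ->
  {in U, forall j, F j \subset E /\ w <= #|F j|} ->
  exists2 e, e \in E & w * #|U| <= M * #|[set j in U | e \in F j]|.
Proof.
move=> EM w0 U0 hF; apply/exists_inP; apply: contraT => /exists_inPn h.
have [j jU] := set0Pn _ U0; have [jE wj] := hF j jU.
have E0 : 0 < #|E| by apply: leq_trans w0 (leq_trans wj (subset_leq_card jE)).
have h1 : \sum_(e in E) M * #|[set j in U | e \in F j]| < \sum_(e in E) w * #|U|.
  have [e eE] := card_gt0P E0.
  rewrite (bigD1 e) //= [X in _ < X](bigD1 e) //= -addSn.
  apply: leq_add; first by rewrite ltnNge h.
  by apply: leq_sum => f /andP[fE _]; rewrite leq_eqVlt ltnNge h // orbT.
rewrite -big_distrr /= sum_nat_const in h1.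
have h2 : \sum_(e in E) #|[set j in U | e \in F j]| = \sum_(j in U) #|F j|.
  under eq_bigr do rewrite -sum1_card.
  rewrite (exchange_big_dep (mem U)) /=; last by move=> e k _; rewrite inE => /andP[].
  apply: eq_bigr => k kU; rewrite -sum1_card; apply: eq_bigl => e.
  rewrite inE kU /=; apply/andP/idP => [[]//|ek]; split=> //.
  by have [/subsetP/(_ _ ek)] := hF k kU.
have h3 : w * #|U| <= \sum_(j in U) #|F j|.
  by rewrite mulnC -sum_nat_const; apply: leq_sum => k /hF[].
rewrite h2 in h1.
have : M * (w * #|U|) < #|E| * (w * #|U|) by apply: leq_ltn_trans h1; rewrite leq_mul2l h3 orbT.
by rewrite ltnNge leq_mul2r EM orbT.
Qed.

(** By [averaging] some element lies in at least a fraction [w / M] of the sets not yet hit, so each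
    greedy choice multiplies their number by at most [1 - w / M]. Multiplying out by [M ^ t] keeps
    the bound in the natural numbers. *)
Lemma greedy_hitting (F : J -> {set I}) (E : {set I}) (P : {set J}) (M w t : nat) :
  #|E| <= M -> {in P, forall j, F j \subset E /\ w <= #|F j|} ->
  exists X : {set I}, [/\ X \subset E, #|X| <= t &
    #|[set j in P | [disjoint F j & X]]| * M ^ t <= #|P| * (M - w) ^ t].
Proof.
move=> EM hF; elim: t => [|t [X [XE Xt hX]]].
  exists set0; rewrite sub0set cards0 !expn0 !muln1; split=> //.
  by apply/subset_leq_card/subsetP => j; rewrite inE => /andP[].
set U := [set j in P | _] in hX.
have [w0|w0] := posnP w.
  exists X; split=> //; first exact: leqW.
  move: hX; rewrite w0 subn0 !expnSr !mulnA => hX.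
  by rewrite leq_mul2r -/U hX orbT.
have [U0|U0] := eqVneq U set0.
  by exists X; split=> //; [exact: leqW | rewrite -/U U0 cards0].
have hU : {in U, forall j, F j \subset E /\ w <= #|F j|}.
  by move=> j; rewrite inE => /andP[/hF].
have [e eE he] := averaging EM w0 U0 hU.
exists (e |: X); split; first by rewrite subUset sub1set eE.
  by rewrite cardsU1 -add1n; apply: leq_add Xt; apply: leq_b1.
set V := [set j in P | _]; set W := [set j in U | e \in F j] in he.
have VU : V \subset U :\: W.
  apply/subsetP => j; rewrite !inE => /andP[-> dj] /=.
  rewrite (disjointWr (subsetUr _ _) dj) andbT /=.
  by apply/negP => h; have := disjointFr dj h; rewrite setU11.
have cV : #|V| <= #|U| - #|W|.
  have WU : W \subset U by apply/subsetP => j; rewrite inE => /andP[].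
  by rewrite -(setIidPr WU) -cardsD subset_leq_card.
have h : #|V| * M <= #|U| * (M - w).
  apply: leq_trans (leq_mul cV (leqnn M)) _; rewrite mulnBl mulnBr.
  by apply: leq_sub2l; rewrite mulnC [X in _ <= X]mulnC.
rewrite !expnS mulnA mulnCA; apply: leq_trans (leq_mul h (leqnn (M ^ t))) _.
by rewrite -mulnA mulnCA leq_mul2l hX orbT.
Qed.

Lemma hitting_set (F : J -> {set I}) (E : {set I}) (P : {set J}) (M w t : nat) :
  #|E| <= M -> {in P, forall j, F j \subset E /\ w <= #|F j|} ->
  #|P| * (M - w) ^ t < M ^ t ->
  exists X : {set I}, [/\ X \subset E, #|X| <= t &
    {in P, forall j, exists2 e, e \in X & e \in F j}].
Proof.
move=> EM hF ht; have [X [XE Xt hX]] := greedy_hitting t EM hF.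
exists X; split=> // j jP.
have h0 : [set j in P | [disjoint F j & X]] = set0.
  apply/eqP; rewrite -cards_eq0 -leqn0 leqNgt; apply/negP => c0.
  have : M ^ t <= #|P| * (M - w) ^ t by apply: leq_trans hX; rewrite leq_pmull.
  by rewrite leqNgt ht.
have : j \notin [set j in P | [disjoint F j & X]] by rewrite h0 inE.
rewrite inE jP /= => /pred0Pn[e /andP[/= eF eX]]; by exists e.
Qed.

End FiniteSets.

(** * Degrees in cycles and typical graphs *)

Section Cycles.
Variable T : finType.
Implicit Types (E G H : {set {set T}}) (U A B S : {set T}).

Lemma min_degree_le E v : min_degree E <= degree E v.
Proof.
rewrite /min_degree; have : v \in index_enum T by rewrite mem_index_enum.
elim: (index_enum T) => // u r IH; rewrite inE big_cons => /orP[/eqP->|/IH h].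
  exact: geq_minl.
exact: leq_trans (geq_minr _ _) h.
Qed.

Lemma degree_hamilton_cycle H v : hamilton_cycle H -> degree H v <= 2.
Proof.
case/andP=> _ /existsP[s /andP[us /eqP->]].
have sub : [set e in cycle_edges s | v \in e] \subset
    [set [set v; next s v]; [set prev s v; v]].
  apply/subsetP => e; rewrite inE => /andP[/imsetP[x xs ->]].
  rewrite !inE => /orP[]/eqP->; first by rewrite eqxx.
  by rewrite prev_next // eqxx orbT.
apply: leq_trans (subset_leq_card sub) _.
by rewrite cards2; case: (_ != _).
Qed.

Lemma card_hamilton_cycle H : hamilton_cycle H -> #|H| <= #|T|.
Proof.
case/andP=> _ /existsP[s /andP[us /eqP->]].
by apply: leq_trans (leq_imset_card _ _) (max_card _).
Qed.

Definition between A B : {set {set T}} := [set [set x; y] | x in A, y in B].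

(* [kd] bounds the degrees of the union of the removed cycles; [w] is what is left of a
   cut after their removal. *)
Record typical E (kd k1 D g w M m : nat) : Prop := Typical {
  typ_far : forall x s, uniq (x :: s) -> 0 < size s <= 4 -> path (adj E) x s ->
    degree E x <= k1 -> degree E (last x s) <= k1 -> False;
  typ_sparse : forall S, 0 < #|S| <= 7 * g ->
    14 * #|[set e in E | e \subset S]| < D * #|S|;
  typ_dense : forall A B, [disjoint A & B] -> g <= #|A| -> #|T| <= 4 * #|B| ->
    w + kd * #|A| <= #|E :&: between A B|;
  typ_edges : #|E| <= M;
  typ_boost : forall G H, G \subset E -> H \subset E -> [disjoint G & H] ->
    #|G| + #|H| <= m -> #|T| ^ 2 <= 32 * #|boosters G| ->
    exists2 e, e \in boosters G & e \in E :\: H }.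

Lemma degreeD E H v : H \subset E -> degree (E :\: H) v = degree E v - degree H v.
Proof.
move=> HE; rewrite /degree -cardsDS; last first.
  by apply/subsetP => e; rewrite !inE => /andP[/(subsetP HE)-> ->].
by apply: eq_card => e; rewrite !inE; case: (v \in e); rewrite ?andbT ?andbF.
Qed.

Lemma card_between_le H A B : #|H :&: between A B| <= \sum_(v in A) degree H v.
Proof.
apply: leq_trans (leq_card_bigcup _ _); apply/subset_leq_card/subsetP => e.
rewrite inE => /andP[eH /imset2P[x y xA yB eE]].
by apply/bigcupP; exists x => //; rewrite inE eH eE set21.
Qed.

End Cycles.

(** * Expansion of small sets in the sparse subgraph *)

Section Residual.
Variable T : finType.
Implicit Types (E G H F : {set {set T}}) (U A B S : {set T}).

Lemma vpairsP F e v : F \subset vpairs T -> e \in F -> v \in e ->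
  exists2 y, y != v & e = [set v; y].
Proof.
move=> FV eF ve; have := subsetP FV _ eF; rewrite inE => /cards2P[a [b [ab eE]]].
move: ve; rewrite eE !inE => /orP[]/eqP vE; first by exists b; rewrite ?vE // eq_sym.
by exists a; rewrite vE // setUC.
Qed.

Definition pick_edges F (k : T -> nat) v : {set {set T}} :=
  [set e in take (k v) (enum [set e in F | v \in e])].

Lemma pick_edgesP F k v e : e \in pick_edges F k v -> e \in F /\ v \in e.
Proof. by rewrite inE => /mem_take; rewrite mem_enum inE => /andP[]. Qed.

Lemma card_pick_edges F k v : k v <= degree F v -> #|pick_edges F k v| = k v.
Proof.
move=> h; rewrite /pick_edges cardsE (card_uniqP _) ?take_uniq ?enum_uniq //.
by rewrite size_take -cardE; case: ltnP => // h'; apply/eqP; rewrite eqn_leq h' h.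
Qed.

Lemma pick_nbrs_card F k v : F \subset vpairs T -> k v <= degree F v ->
  #|[set y | (y != v) && ([set v; y] \in pick_edges F k v)]| = k v.
Proof.
move=> FV h; rewrite -(card_pick_edges h); set Y := [set y | _].
have -> : pick_edges F k v = [set [set v; y] | y in Y].
  apply/setP => e; apply/idP/imsetP => [eP|[y]]; last first.
    by rewrite inE => /andP[_ ?] ->.
  have [eF ve] := pick_edgesP eP; have [y yv eE] := vpairsP FV eF ve.
  by exists y => //; rewrite inE yv -eE.
rewrite card_in_imset // => y y' yY _ /eq_set2[[]//|[_ yv]].
by move: yY; rewrite inE yv eqxx.
Qed.

(** If the conclusion fails, [S], the union of [U] and its neighbourhood, has fewer than [7 * #|U|]
    vertices. It contains every edge picked at [U], hence at least [D * #|U| / 2] edges. Sparsity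
    allows fewer than [D * #|S| / 14], which is at most [D * #|U| / 2]. *)
Lemma large_expansion E F G (k : T -> nat) (D : nat) U :
  E \subset vpairs T -> F \subset E -> (forall v, pick_edges F k v \subset G) ->
  G \subset E -> {in U, forall v, k v = D /\ D <= degree F v} ->
  (forall S, 0 < #|S| <= 7 * #|U| -> 14 * #|[set e in E | e \subset S]| < D * #|S|) ->
  6 * #|U| <= #|nbhd G U|.
Proof.
move=> EV FE PG GE kD sp; rewrite leqNgt; apply/negP => hN.
have U0 : 0 < #|U| by lia.
set S := U :|: nbhd G U.
have cS : #|S| <= #|U| + #|nbhd G U| by apply: leq_card_setU.
have US : #|U| <= #|S| by apply/subset_leq_card/subsetUl.
have := sp S; have -> : 0 < #|S| <= 7 * #|U| by apply/andP; split; lia.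
move=> /(_ isT); set K := [set e in E | _] => hK.
have KD : D * #|U| <= 2 * #|K|.
  apply: (@leq_trans (\sum_(v : T) degree K v)); last first.
    rewrite sum_degree mulnC -sum_nat_const; apply: leq_sum => e.
    by rewrite inE => /andP[/(subsetP EV)]; rewrite inE => /eqP->.
  rewrite mulnC -sum_nat_const [X in _ <= X](bigID (mem U)) /=.
  apply: leq_trans (leq_addr _ _); apply: leq_sum => v vU.
  have [kv dv] := kD v vU.
  rewrite -{1}kv -(@card_pick_edges F) ?kv //; apply/subset_leq_card/subsetP => e eP.
  have [eF ve] := pick_edgesP eP.
  rewrite !inE (subsetP FE _ eF) ve andbT /=.
  have eG := subsetP (PG v) _ eP.
  have [y yv eE] := vpairsP EV (subsetP FE _ eF) ve.
  apply/subsetP => x; rewrite eE !inE => /orP[]/eqP->; first by rewrite vU.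
  have [//|yU] := boolP (y \in U); apply/orP; right; apply/andP; split=> //.
  by apply/existsP; exists v; rewrite vU /adj eq_sym yv -eE.
have : D * #|S| <= D * (7 * #|U|) by rewrite leq_mul2l; apply/orP; right; lia.
lia.
Qed.

Definition small_vertices E (k1 : nat) : {set T} := [set v | degree E v <= k1].

(** Split [U] into its low-degree part [US] and the rest [UL]. As low-degree vertices are far apart,
    the picked neighbours [TU] of [US] number exactly [2 * #|US|] and have high degree. The set [UL]
    has at least [6 * #|UL|] neighbours, and those inside [US :|: TU] are few because each vertex of
    [UL] sees at most one group formed by a low-degree vertex and its two picked neighbours. *)
Lemma small_set_expansion E F G (k : T -> nat) (k1 D g : nat) U :
  E \subset vpairs T -> F \subset E -> (forall v, pick_edges F k v \subset G) ->
  G \subset E ->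
  (forall v, k v = if degree E v <= k1 then 2 else D) ->
  (forall v, k v <= degree F v) ->
  (forall S, 0 < #|S| <= 7 * g -> 14 * #|[set e in E | e \subset S]| < D * #|S|) ->
  (forall x s, uniq (x :: s) -> 0 < size s <= 4 -> path (adj E) x s ->
    degree E x <= k1 -> degree E (last x s) <= k1 -> False) ->
  #|U| <= g -> 2 * #|U| <= #|nbhd G U|.
Proof.
move=> EV FE PG GE kE kF sp far Ug.
pose sm := small_vertices E k1; pose US := U :&: sm; pose UL := U :\: sm.
have hL : 6 * #|UL| <= #|nbhd G UL|.
  apply: (@large_expansion E F G k D) => //.
    by move=> v; rewrite !inE => /andP[h _]; have := kE v; rewrite (negPf h) => <-; split.
  move=> S /andP[S0 hS]; apply: sp; rewrite S0 (leq_trans hS) // leq_mul2l /=.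
  by apply: leq_trans Ug; apply/subset_leq_card/subsetDl.
pose tn s := [set y | (y != s) && ([set s; y] \in pick_edges F k s)].
have tnadj s y : y \in tn s -> adj E s y.
  rewrite inE => /andP[ys h]; rewrite /adj eq_sym ys.
  by apply: (subsetP GE); apply: (subsetP (PG s)).
have tnadjG s y : y \in tn s -> adj G s y.
  rewrite inE => /andP[ys h]; rewrite /adj eq_sym ys.
  exact: (subsetP (PG s)).
have ctn s : s \in sm -> #|tn s| = 2.
  by rewrite inE => h; rewrite /tn pick_nbrs_card ?(subset_trans FE) // kE h.
have adjne x y : adj E x y -> x != y by case/andP.
have far1 s s' : s \in sm -> s' \in sm -> ~~ adj E s s'.
  rewrite !inE => hs hs'; apply/negP => a.
  by apply: (far s [:: s']) => //=; rewrite ?inE ?a ?(adjne _ _ a).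
have far2 s s' u : s \in sm -> s' \in sm -> s != s' -> adj E s u -> adj E u s' -> False.
  rewrite !inE => hs hs' ss' a b.
  apply: (far s [:: u; s']) => //=; rewrite ?a ?b // !inE negb_or ss'.
  by rewrite (adjne _ _ a) (adjne _ _ b).
have far3 s s' u v : s \in sm -> s' \in sm -> s != s' ->
    adj E s u -> adj E u v -> adj E v s' -> s != v -> u != s' -> False.
  rewrite !inE => hs hs' ss' a b c sv us'.
  apply: (far s [:: u; v; s']) => //=; rewrite ?a ?b ?c // !inE !negb_or ss' sv us'.
  by rewrite (adjne _ _ a) (adjne _ _ b) (adjne _ _ c).
have far4 s s' u v w : s \in sm -> s' \in sm -> s != s' ->
    adj E s u -> adj E u v -> adj E v w -> adj E w s' ->
    s != v -> u != s' -> s != w -> u != w -> v != s' -> False.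
  rewrite !inE => hs hs' ss' a b c d sv us' sw uw vs'.
  apply: (far s [:: u; v; w; s']) => //=; rewrite ?a ?b ?c ?d //.
  rewrite !inE !negb_or ss' sv us' sw uw vs'.
  by rewrite (adjne _ _ a) (adjne _ _ b) (adjne _ _ c) (adjne _ _ d).
pose TU := \bigcup_(s in US) tn s.
have smUS s : s \in US -> s \in sm by case/setIP.
have TUsm y : y \in TU -> y \notin sm.
  case/bigcupP => s /smUS ss /tnadj a; apply/negP => ys.
  by have := far1 s y ss ys; rewrite a.
have cTU : #|TU| = 2 * #|US|.
  rewrite /TU card_bigcup_disjoint.
    by rewrite mulnC -sum_nat_const; apply: eq_bigr => s /smUS/ctn.
  move=> s s' /smUS hs /smUS hs' ss'; apply/pred0P => y /=; apply/negP => /andP[y1 y2].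
  apply: (far2 s s' y) => //; first exact: tnadj.
  by rewrite adj_sym; apply: tnadj.
pose Wu u := [set y in US :|: TU | adj G u y].
have anchor u y : y \in Wu u -> exists2 s, s \in US & y \in s |: tn s.
  rewrite inE => /andP[/setUP[yS|/bigcupP[s sU ys]] _]; last by exists s; rewrite // inE ys orbT.
  by exists y; rewrite // setU11.
(* Two different groups seen from [u] would join [s] and [s'] by a path [s y u y' s'] of at most
   four edges. This is the source of the distance 4 in [typical]. *)
have same u s s' y y' : u \in UL -> s \in US -> s' \in US ->
    y \in s |: tn s -> y' \in s' |: tn s' -> adj E u y -> adj E u y' -> s = s'.
  move=> uL sU s'U hy hy' a b; apply/eqP/negPn/negP => ss'.
  have us : u \notin sm by move: uL; rewrite inE => /andP[].
  have su : s != u by apply: contraNneq us => <-; apply: smUS.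
  have s'u : s' != u by apply: contraNneq us => <-; apply: smUS.
  have Tsm z t : t \in US -> z \in tn t -> z \notin sm.
    by move=> tU zt; apply: TUsm; apply/bigcupP; exists t.
  case/setU1P: hy => [yE|yt]; case/setU1P: hy' => [yE'|yt'].
  - subst y y'; apply: (far2 s s' u); rewrite ?smUS //; by rewrite adj_sym.
  - subst y; apply: (far3 s s' u y'); rewrite ?smUS //; first by rewrite adj_sym.
    + by rewrite adj_sym; apply: tnadj.
    + by apply: contraNneq (Tsm _ _ s'U yt') => <-; apply: smUS.
    + by rewrite eq_sym.
  - subst y'; apply: (far3 s s' y u); rewrite ?smUS //; first exact: tnadj.
    + by rewrite adj_sym.
    + by apply: contraNneq (Tsm _ _ sU yt) => ->; apply: smUS.
  - have [yy|yy] := eqVneq y y'.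
      subst y'; apply: (far2 s s' y); rewrite ?smUS //; first exact: tnadj.
      by rewrite adj_sym; apply: tnadj.
    apply: (far4 s s' y u y'); rewrite ?smUS //; first exact: tnadj.
    + by rewrite adj_sym.
    + by rewrite adj_sym; apply: tnadj.
    + by apply: contraNneq (Tsm _ _ sU yt) => ->; apply: smUS.
    + by apply: contraNneq (Tsm _ _ s'U yt') => <-; apply: smUS.
    + by rewrite eq_sym.
have cW u : u \in UL -> #|Wu u| <= 3.
  move=> uL; have [->|/set0Pn[y yW]] := eqVneq (Wu u) set0; first by rewrite cards0.
  have [s sU ys] := anchor _ _ yW.
  have adjW z : z \in Wu u -> adj E u z by rewrite inE => /andP[_ /(adj_subset GE)].
  have sub : Wu u \subset s |: tn s.
    apply/subsetP => z zW; have [s' s'U zs'] := anchor _ _ zW.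
    by rewrite (same u s s' y z) // adjW.
  apply: leq_trans (subset_leq_card sub) _; rewrite cardsU1.
  by rewrite ctn ?smUS //; case: (_ \notin _).
pose W := nbhd G UL :&: (US :|: TU).
have cWW : #|W| <= 3 * #|UL|.
  apply: (@leq_trans #|\bigcup_(u in UL) Wu u|).
    apply/subset_leq_card/subsetP => y; rewrite inE => /andP[/nbhdP[_ [u uL uy]] yS].
    by apply/bigcupP; exists u; rewrite // inE yS.
  apply: leq_trans (leq_card_bigcup _ _) _; rewrite mulnC -sum_nat_const.
  exact: leq_sum.
pose N1 := nbhd G UL :\: (US :|: TU); pose N2 := TU :\: UL.
have N12 : [disjoint N1 & N2].
  by apply/pred0P => y /=; rewrite !inE negb_or; case: (y \in TU); rewrite /= ?andbF.
have sub : N1 :|: N2 \subset nbhd G U.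
  apply/subsetP => y /setUP[/setDP[/nbhdP[yL [u uL uy]]]|/setDP[yT yL]].
    rewrite inE negb_or => /andP[yS _]; apply/nbhdP; split.
      by apply: contra yL => yU; rewrite inE yU andbT; apply: contra yS => ys; rewrite inE yU.
    by exists u => //; case/setDP: uL.
  apply/nbhdP; split; first by apply: contra yL => yU; rewrite inE yU andbT TUsm.
  case/bigcupP: yT => s sU ys; exists s; last exact: tnadjG.
  by case/setIP: sU.
have c1 : #|nbhd G UL| = #|W| + #|N1| by rewrite /N1 cardsID.
have c2 : #|TU| <= #|UL| + #|N2|.
  rewrite -(cardsID UL TU) leq_add2r; apply/subset_leq_card/subsetIr.
have c3 : #|N1| + #|N2| <= #|nbhd G U|.
  have := subset_leq_card sub.
  by rewrite cardsU (disjoint_setI0 N12) cards0 subn0.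
have c4 : #|U| = #|US| + #|UL| by rewrite cardsID.
(* The count is [(6 - 3) * #|UL|] from [N1] plus [2 * #|US| - #|UL|] from [N2], that is
   [2 * #|U|]. *)
lia.
Qed.

End Residual.

(** * Hamiltonicity of the residual graph and induction on the number of cycles *)

Section Packing.
Variable T : finType.
Implicit Types (E G H F : {set {set T}}) (U A B S : {set T}).

Lemma degree_bigcup (I : finType) (C : I -> {set {set T}}) v :
  degree (\bigcup_i C i) v <= \sum_i degree (C i) v.
Proof.
rewrite {1}/degree; apply: leq_trans (_ : #|\bigcup_(i in setT) [set e in C i | v \in e]| <= _).
  apply/subset_leq_card/subsetP => e; rewrite inE => /andP[/bigcupP[i _ eC] ve].
  by apply/bigcupP; exists i; rewrite ?inE ?eC.
apply: leq_trans (leq_card_bigcup _ _) _; apply: eq_leq.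
by apply: eq_bigl => i; rewrite inE.
Qed.

Lemma residual_hamiltonian E H (kd k1 D g w M m t : nat) :
  E \subset vpairs T -> H \subset E -> typical E kd k1 D g w M m ->
  (forall v, degree H v + 2 <= degree E v) -> (forall v, degree H v <= kd) ->
  3 < #|T| -> 2 <= D -> D + kd <= k1 -> 4 * g <= #|T| ->
  4 ^ #|T| * (M - w) ^ t < M ^ t ->
  #|H| + #|T| * D + t + #|T| <= m ->
  hamiltonian (E :\: H).
Proof.
move=> EV HE typ dH2 dHk T3 D2 Dk g4 hit hm.
set F := E :\: H; have FE : F \subset E by apply: subsetDl.
(* The test uses the degree in [E], because [typical] separates low-degree vertices of [E]. The
   picks are available in [F]: a vertex above [k1] loses at most [kd] edges and keeps [D] since
   [D + kd <= k1], and every vertex keeps two. *)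
pose k v := if degree E v <= k1 then 2 else D.
have kF v : k v <= degree F v.
  rewrite degreeD // /k; have h1 := dH2 v; have h2 := dHk v.
  by case: (leqP (degree E v) k1) => hv; lia.
have kD v : k v <= D by rewrite /k; case: ifP.
pose P : {set {set T} * {set T}} :=
  [set AB : {set T} * {set T} | [&& [disjoint AB.1 & AB.2], g <= #|AB.1| & #|T| <= 4 * #|AB.2|]].
pose Fj (AB : {set T} * {set T}) := F :&: between AB.1 AB.2.
have hF : {in P, forall j, Fj j \subset F /\ w <= #|Fj j|}.
  move=> [A B]; rewrite inE => /and3P[/= dAB gA nB]; split; first exact: subsetIl.
  have h1 := typ_dense typ dAB gA nB.
  have h2 : #|E :&: between A B| <= #|Fj (A, B)| + #|H :&: between A B|.
    rewrite -(cardsID H (E :&: between A B)) addnC; apply: leq_add.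
      by apply/subset_leq_card/subsetP => e; rewrite !inE => /andP[-> /andP[-> ->]].
    by apply/subset_leq_card/subsetP => e; rewrite !inE => /andP[/andP[_ ->] ->].
  have h3 : #|H :&: between A B| <= kd * #|A|.
    apply: leq_trans (card_between_le _ _ _) _; rewrite mulnC -sum_nat_const.
    by apply: leq_sum => v _.
  rewrite -(leq_add2r (kd * #|A|)); apply: leq_trans h1 _; apply: leq_trans h2 _.
  by rewrite leq_add2l.
have FM : #|F| <= M by apply: leq_trans (typ_edges typ); apply: subset_leq_card.
(* There are at most [4 ^ #|T|] pairs [(A, B)], and each cut keeps [w] edges after the removal of
   [H]. *)
have [|X [XF Xt hX]] := hitting_set (t := t) FM hF.
  apply: leq_ltn_trans hit; rewrite leq_mul2r; apply/orP; right.
  apply: leq_trans (max_card _) _; rewrite card_prod -cardsT -powersetT card_powerset cardsT.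
  by rewrite -expnMn.
have XP A B : [disjoint A & B] -> g <= #|A| -> #|T| <= 4 * #|B| ->
    exists x y, [/\ x \in A, y \in B & adj X x y].
  move=> dAB gA nB; have [|e eX] := hX (A, B); first by rewrite inE dAB gA nB.
  rewrite inE => /andP[_ /imset2P[x y /= xA yB eE]]; exists x, y; split=> //.
  rewrite /adj -eE eX andbT; apply: contraTneq yB => <-.
  by rewrite (disjointFr dAB xA).
pose G0 := (\bigcup_v pick_edges F k v) :|: X.
have PG v : pick_edges F k v \subset G0.
  by apply: subset_trans (subsetUl _ _); apply: bigcup_sup.
have G0F : G0 \subset F.
  rewrite subUset XF andbT; apply/bigcupsP => v _.
  by apply/subsetP => e /pick_edgesP[].
have XG0 : X \subset G0 by apply: subsetUr.
have cG0 : #|G0| <= #|T| * D + t.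
  apply: leq_trans (leq_card_setU _ _) _; apply: leq_add => //.
  have -> : \bigcup_v pick_edges F k v = \bigcup_(v in [set: T]) pick_edges F k v.
    by apply: eq_bigl => v; rewrite inE.
  apply: leq_trans (leq_card_bigcup _ _) _; rewrite -cardsT -sum_nat_const.
  by apply: leq_sum => v _; rewrite card_pick_edges.
have ex : expander G0.
  move=> U U4; have [gU|Ug] := leqP g #|U|; last first.
    apply: (@small_set_expansion T E F G0 k k1 D g) => //.
    - exact: subset_trans G0F FE.
    - exact: typ_sparse typ.
    - exact: typ_far typ.
    - exact: ltnW.
  (* If a linear [U] fails to expand, [U] and its neighbours are fewer than [3 * #|U|], at most
     three quarters of the vertices. So [B] is linear, and [X] has an edge from [U] to [B], which is
     absurd. *)
  rewrite leqNgt; apply/negP => hN; set B := ~: (U :|: nbhd G0 U).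
  have cB : #|T| <= 4 * #|B|.
    have := cardsC (U :|: nbhd G0 U); rewrite -/B.
    have h : #|U :|: nbhd G0 U| <= #|U| + #|nbhd G0 U| by apply: leq_card_setU.
    lia.
  have dUB : [disjoint U & B].
    by apply/pred0P => y /=; rewrite !inE; case: (y \in U).
  have [x [y [xU yB xy]]] := XP U B dUB gU cB.
  move: yB; rewrite !inE negb_or => /andP[yU]; rewrite yU /= => /negP; apply.
  by apply/existsP; exists x; rewrite xU (adj_subset XG0).
have conn : connected_graph G0.
  (* If [U] or its complement has at most [n / 4] vertices, expansion gives a crossing edge;
     otherwise both sides are linear and [X] crosses the cut. *)
  move=> U U0 UT; have [U4|U4] := leqP (4 * #|U|) #|T|.
    have := ex U U4; rewrite -card_gt0 in U0.
    by rewrite -card_gt0; apply: leq_trans; lia.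
  have cC := cardsC U.
  have [C4|C4] := leqP (4 * #|~: U|) #|T|.
    have C0 : 0 < #|~: U|.
      rewrite card_gt0; apply: contra_neq UT => h; by rewrite -(setCK U) h setC0.
    have : 0 < #|nbhd G0 (~: U)| by apply: leq_trans (ex _ C4); lia.
    case/card_gt0P => y /nbhdP[]; rewrite inE negbK => yU [x]; rewrite inE => xU xy.
    by apply/set0Pn; exists x; apply/nbhdP; split=> //; exists y; rewrite // adj_sym.
  have dU : [disjoint U & ~: U] by rewrite disjoints_subset setCK.
  have gU : g <= #|U| by move: g4 U4; clear; lia.
  have [x [y [xU yC xy]]] := XP U (~: U) dU gU (ltnW C4).
  apply/set0Pn; exists y; apply/nbhdP; split; first by move: yC; rewrite inE.
  by exists x; rewrite ?(adj_subset XG0).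
apply: (hamiltonian_boost _ conn G0F); first exact: ltnW.
move=> G sG GF cG; apply: (typ_boost typ) => //.
- exact: subset_trans GF FE.
- apply/pred0P => e /=; apply/negP => /andP[/(subsetP GF)]; rewrite inE => /andP[/negP].
  by [].
- by lia.
- by apply: card_boosters => //; apply: expander_subset sG ex.
Qed.

Lemma edge_disjoint_hamilton_cycles0 E : edge_disjoint_hamilton_cycles E 0.
Proof. by apply/existsP; exists [ffun=> set0]; apply/andP; split; apply/forallP => -[]. Qed.

(** Since [typical] is uniform over the removed graph, the same hypotheses serve at every step of
    the induction, however the earlier cycles were chosen. *)
Lemma hamilton_packing E (kd k1 D g w M m t : nat) :
  E \subset vpairs T -> typical E kd k1 D g w M m -> min_degree E <= kd ->
  3 < #|T| -> 2 <= D -> D + kd <= k1 -> 4 * g <= #|T| ->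
  4 ^ #|T| * (M - w) ^ t < M ^ t ->
  #|T| * kd./2 + #|T| * D + t + #|T| <= m ->
  edge_disjoint_hamilton_cycles E (min_degree E)./2.
Proof.
move=> EV typ hkd T3 D2 Dk g4 hit hm.
have : forall i, i <= (min_degree E)./2 -> edge_disjoint_hamilton_cycles E i.
  elim=> [_|i IH iE]; first exact: edge_disjoint_hamilton_cycles0.
  have /existsP[C /andP[/forallP hC /forallP dC]] := IH (ltnW iE).
  set H := \bigcup_j C j.
  have HE : H \subset E by apply/bigcupsP => j _; have /andP[] := hC j.
  (* The [i] cycles found so far take at most [2 * i] edges at a vertex, so this leaves residual
     degree 2 everywhere. *)
  have i2 : 2 * i.+1 <= min_degree E.
    by rewrite -(odd_double_half (min_degree E)) -mul2n; lia.
  have dH v : degree H v <= 2 * i.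
    apply: leq_trans (degree_bigcup _ _) _.
    rewrite mulnC -[X in X * 2]card_ord -sum_nat_const; apply: leq_sum => j _.
    by apply: degree_hamilton_cycle; have /andP[] := hC j.
  have cH : #|H| <= #|T| * i.
    have -> : H = \bigcup_(j in [set: 'I_i]) C j by apply: eq_bigl => j; rewrite inE.
    apply: leq_trans (leq_card_bigcup _ _) _.
    rewrite mulnC -[X in X * #|T|]card_ord -[X in X * #|T|]cardsT -sum_nat_const; apply: leq_sum => j _.
    by apply: card_hamilton_cycle; have /andP[] := hC j.
  have dH2 v : degree H v + 2 <= degree E v.
    by have := min_degree_le E v; have := dH v; lia.
  have dHk v : degree H v <= kd by have := dH v; lia.
  have hm' : #|H| + #|T| * D + t + #|T| <= m.
    have : #|T| * i <= #|T| * kd./2 by rewrite leq_mul2l; apply/orP; right; lia.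
    lia.
  have [K hK sK] := residual_hamiltonian EV HE typ dH2 dHk T3 D2 Dk g4 hit hm'.
  pose C' : {ffun 'I_i.+1 -> {set {set T}}} := [ffun j => if unlift ord_max j is Some k then C k else K].
  have dK k : [disjoint C k & K].
    apply/pred0P => e /=; apply/negP => /andP[eC /(subsetP sK)].
    by rewrite inE => /andP[/negP[]]; apply/bigcupP; exists k.
  apply/existsP; exists C'; apply/andP; split; apply/forallP => j.
    rewrite ffunE; case: unliftP => [k _|_]; first exact: hC.
    by rewrite hK (subset_trans sK) // subsetDl.
  apply/forallP => j'; apply/implyP => jj'; rewrite !ffunE.
  case: unliftP jj' => [k ->|->]; case: unliftP => [k' ->|->] jj'.
  - have /forallP/(_ k')/implyP := dC k; apply.
    by apply: contra_neq jj' => ->.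
  - exact: dK.
  - by rewrite disjoint_sym.
  - by rewrite eqxx in jj'.
exact.
Qed.

End Packing.

Local Open Scope ring_scope.

(** * Moments of the random graph *)

Section ProductMeasure.
Variables (R : realType) (I : finType).
Implicit Types (V E Q Z W : {set I}).

Lemma sum_subsets_prod V (a b : I -> R) :
  \sum_(E : {set I} | E \subset V) \prod_(e in V) (if e \in E then a e else b e) =
  \prod_(e in V) (a e + b e).
Proof.
rewrite [RHS]big_mkcond /=.
(* The value 0 of [a'] outside [V] kills the terms of sets not contained in [V]. *)
pose a' e := if e \in V then a e else 0; pose b' e := if e \in V then b e else 1.
have -> : \prod_i (if i \in V then a i + b i else 1) = \prod_i (a' i + b' i).
  by apply: eq_bigr => i _; rewrite /a' /b'; case: ifP => // _; rewrite add0r.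
rewrite bigA_distr [LHS]big_mkcond /=; apply: eq_bigr => E _.
case: ifPn => [EV|/subsetPn[e eE eV]].
  rewrite big_mkcond /=; apply: eq_bigr => e _; rewrite /a' /b'.
  case: ifPn => eV; last by rewrite (contraNF (subsetP EV e)).
  by case: ifP.
by rewrite (bigD1 e) //= eE /a' (negPf eV) mul0r.
Qed.

Lemma prod_if_const V Q (c : R) : Q \subset V ->
  \prod_(e in V) (if e \in Q then c else 1) = c ^+ #|Q|.
Proof.
move=> QV; rewrite -prodr_const big_mkcond [RHS]big_mkcond /=.
apply: eq_bigr => e _; case: ifPn => // eV.
by rewrite (contraNF (subsetP QV e)).
Qed.

Lemma prod_bool V (b : I -> bool) :
  \prod_(e in V) (b e)%:R = ([forall e in V, b e])%:R :> R.
Proof.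
case: (boolP [forall e in V, b e]) => [/forall_inP h|]; first by apply: big1 => e /h->.
by rewrite negb_forall_in => /exists_inP[e eV be]; rewrite (bigD1 e) //= (negPf be) mul0r.
Qed.

(** The common source of the first and second moments below: [Q] is prescribed present, [Z]
    prescribed absent, and edges in [W] are tilted by [x]. All three factors are products over [V],
    so the sum factors; [a e] and [b e] are the weights of [e] present and absent. *)
Lemma moment_pattern V Q Z W (p x : R) : Q \subset V -> Z \subset V -> W \subset V ->
  [disjoint Q & Z] -> [disjoint Q & W] -> [disjoint Z & W] ->
  \sum_(E : {set I} | E \subset V)
     (\prod_(e in V) (if e \in E then p else 1 - p)) *
     ((Q \subset E)%:R * [disjoint E & Z]%:R * x ^+ #|E :&: W|) =
  p ^+ #|Q| * (1 - p) ^+ #|Z| * (1 - p + p * x) ^+ #|W|.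
Proof.
move=> QV ZV WV QZ QW ZW.
pose a e := p * ((e \notin Z)%:R * (if e \in W then x else 1)).
pose b e := (1 - p) * (e \notin Q)%:R.
transitivity (\prod_(e in V) (a e + b e)).
  rewrite -sum_subsets_prod; apply: eq_bigr => E EV.
  have -> : (Q \subset E)%:R = \prod_(e in V) (if e \in E then 1 else (e \notin Q)%:R) :> R.
    transitivity (\prod_(e in V) ((e \notin E) ==> (e \notin Q))%:R : R); last first.
      by apply: eq_bigr => e _; case: (e \in E).
    rewrite prod_bool; congr ((nat_of_bool _)%:R); apply/subsetP/forall_inP => h e.
      by move=> _; apply/implyP; apply: contra; apply: h.
    by move=> eQ; have := h e (subsetP QV _ eQ); rewrite eQ implybF negbK.
  have -> : [disjoint E & Z]%:R = \prod_(e in V) (if e \in E then (e \notin Z)%:R else 1) :> R.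
    transitivity (\prod_(e in V) ((e \in E) ==> (e \notin Z))%:R : R); last first.
      by apply: eq_bigr => e _; case: (e \in E).
    rewrite prod_bool; congr ((nat_of_bool _)%:R).
    apply/pred0P/forall_inP => [h e _|h e /=].
      by apply/implyP => eE; have := h e; rewrite /= eE /= => ->.
    by apply/negP => /andP[eE eZ]; have /implyP/(_ eE) := h e (subsetP EV _ eE); rewrite eZ.
  have -> : x ^+ #|E :&: W| =
      \prod_(e in V) (if e \in E then (if e \in W then x else 1) else 1).
    rewrite -(@prod_if_const V); last by apply: subset_trans WV; apply: subsetIr.
    by apply: eq_bigr => e _; rewrite inE; case: (e \in E).
  rewrite -!big_split /=; apply: eq_bigr => e _; rewrite /a /b.
  by case: (e \in E); rewrite ?mul1r ?mulr1.
rewrite -(prod_if_const _ QV) -(prod_if_const _ ZV) -(prod_if_const _ WV) -!big_split /=.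
apply: eq_bigr => e _; rewrite /a /b.
have [eQ|eQ] := boolP (e \in Q).
  by rewrite (disjointFr QZ eQ) (disjointFr QW eQ) /= !mulr1 mulr0 addr0.
have [eZ|eZ] := boolP (e \in Z); first by rewrite (disjointFr ZW eZ) /=; ring.
by case: (e \in W) => /=; ring.
Qed.

Lemma sum_subsets_exp V (x : R) :
  \sum_(E : {set I} | E \subset V) x ^+ #|E| = (1 + x) ^+ #|V|.
Proof.
transitivity (\prod_(e in V) (x + 1)); last by rewrite prodr_const addrC.
by rewrite -sum_subsets_prod; apply: eq_bigr => E EV; rewrite prod_if_const.
Qed.

End ProductMeasure.

Section Gnp.
Variables (R : realType) (n : nat) (p : R).
Hypothesis p01 : 0 <= p <= 1.
Local Notation T := 'I_n.
Local Notation V := (vpairs T).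
Implicit Types (E Q Z W G H : {set {set T}}) (A B : pred {set {set T}}).

Definition gnp_exp (f : {set {set T}} -> R) : R :=
  \sum_(E : {set {set T}} | E \subset V) gnp_weight p E * f E.

Lemma gnp_weight_ge0 E : 0 <= gnp_weight p E.
Proof.
case/andP: p01 => p0 p1; apply: prodr_ge0 => e _.
by case: ifP => _ //; rewrite subr_ge0.
Qed.

Lemma gnp_exp_pattern Q Z W (x : R) : Q \subset V -> Z \subset V -> W \subset V ->
  [disjoint Q & Z] -> [disjoint Q & W] -> [disjoint Z & W] ->
  gnp_exp (fun E => (Q \subset E)%:R * [disjoint E & Z]%:R * x ^+ #|E :&: W|) =
  p ^+ #|Q| * (1 - p) ^+ #|Z| * (1 - p + p * x) ^+ #|W|.
Proof. exact: moment_pattern. Qed.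

Lemma gnp_expZ (c : R) f : gnp_exp (fun E => c * f E) = c * gnp_exp f.
Proof. by rewrite /gnp_exp big_distrr /=; apply: eq_bigr => E _; rewrite mulrCA. Qed.

Lemma gnp_expD f g : gnp_exp (fun E => f E + g E) = gnp_exp f + gnp_exp g.
Proof. by rewrite /gnp_exp -big_split /=; apply: eq_bigr => E _; rewrite mulrDr. Qed.

Lemma gnp_exp_sum (J : finType) (P : pred J) (f : J -> {set {set T}} -> R) :
  gnp_exp (fun E => \sum_(j | P j) f j E) = \sum_(j | P j) gnp_exp (f j).
Proof.
rewrite /gnp_exp exchange_big /=; apply: eq_bigr => E _; by rewrite big_distrr.
Qed.

Lemma gnp_exp_le f g : (forall E, E \subset V -> f E <= g E) -> gnp_exp f <= gnp_exp g.
Proof.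
move=> fg; apply: ler_sum => E EV; apply: ler_wpM2l; [exact: gnp_weight_ge0 | exact: fg].
Qed.

Lemma gnp_exp1 : gnp_exp (fun=> 1) = 1.
Proof.
have d0 E : [disjoint set0 & E] by rewrite disjoints_subset sub0set.
have := @gnp_exp_pattern set0 set0 set0 1.
rewrite !sub0set !cards0 !expr0 !mulr1 !d0 => /(_ isT isT isT isT isT isT) h.
rewrite -[RHS]h; apply: eq_bigr => E _.
by rewrite sub0set setI0 cards0 expr0 disjoint_sym d0 !mulr1.
Qed.

Lemma gnp_prob_exp A : gnp_prob p A = gnp_exp (fun E => (A E)%:R).
Proof.
rewrite /gnp_prob /gnp_exp big_mkcondr /=; apply: eq_bigr => E _.
by case: (A E); rewrite ?mulr1 ?mulr0.
Qed.

Lemma gnp_prob_compl A : gnp_prob p A = 1 - gnp_prob p (fun E => ~~ A E).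
Proof.
rewrite -gnp_exp1 !gnp_prob_exp /gnp_exp -sumrB; apply: eq_bigr => E _.
by case: (A E); rewrite ?mulr1 ?mulr0 ?subr0 ?subrr.
Qed.

Lemma gnp_prob_ge0 A : 0 <= gnp_prob p A.
Proof. by apply: sumr_ge0 => E _; apply: gnp_weight_ge0. Qed.

Lemma gnp_prob_le A B : (forall E, E \subset V -> A E -> B E) ->
  gnp_prob p A <= gnp_prob p B.
Proof.
move=> AB; rewrite !gnp_prob_exp; apply: gnp_exp_le => E EV; rewrite ler_nat.
by have := AB E EV; case: (A E) => // ->.
Qed.

Lemma gnp_probU A B : gnp_prob p (fun E => A E || B E) <= gnp_prob p A + gnp_prob p B.
Proof.
rewrite !gnp_prob_exp /gnp_exp -big_split /=; apply: ler_sum => E _.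
rewrite -mulrDr; apply: ler_wpM2l; first exact: gnp_weight_ge0.
by rewrite -natrD ler_nat; case: (A E); case: (B E).
Qed.

(** Markov's inequality and the union bound in one. With [f j] an exponential weight it gives
    Chernoff bounds, with a square it gives Chebyshev's inequality. *)
Lemma gnp_union (J : finType) (P : pred J) (f : J -> {set {set T}} -> R) A :
  (forall j E, 0 <= f j E) ->
  (forall E, E \subset V -> A E -> exists2 j, P j & 1 <= f j E) ->
  gnp_prob p A <= \sum_(j | P j) gnp_exp (f j).
Proof.
move=> f0 hA; rewrite -gnp_exp_sum gnp_prob_exp; apply: gnp_exp_le => E EV.
case: (boolP (A E)) => [/(hA E EV)[j Pj fj]|_]; last exact: sumr_ge0.
by rewrite (bigD1 j) //= (le_trans fj) // lerDl sumr_ge0.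
Qed.

End Gnp.

Section Between.
Variable T : finType.
Implicit Types (A B S : {set T}) (E : {set {set T}}).

Lemma between_vpairs A B : [disjoint A & B] -> between A B \subset vpairs T.
Proof.
move=> dAB; apply/subsetP => e /imset2P[x y xA yB ->]; rewrite inE cards2 eqSS eqb1.
by apply: contraTneq yB => <-; rewrite (disjointFr dAB xA).
Qed.

Lemma card_between A B : [disjoint A & B] -> #|between A B| = (#|A| * #|B|)%N.
Proof.
move=> dAB; rewrite /between curry_imset2X card_in_imset ?cardsX //.
move=> [x y] [x' y']; rewrite !inE /= => /andP[xA yB] /andP[x'A y'B] /eq_set2[[-> ->]//|[xy _]].
by move: y'B; rewrite -xy (disjointFr dAB xA).
Qed.

Definition inner_pairs S : {set {set T}} := [set e : {set T} | (e \subset S) && (#|e| == 2)].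

Lemma inner_pairs_vpairs S : inner_pairs S \subset vpairs T.
Proof. by apply/subsetP => e; rewrite !inE => /andP[]. Qed.

Lemma card_inner_pairs S : #|inner_pairs S| = 'C(#|S|, 2).
Proof. exact: cards_draws. Qed.

Lemma card_vpairs : #|vpairs T| = 'C(#|T|, 2).
Proof. exact: card_draws. Qed.

Lemma inner_edges E S : E \subset vpairs T -> [set e in E | e \subset S] = E :&: inner_pairs S.
Proof.
move=> EV; apply/setP => e; rewrite !inE; have [eE|] //= := boolP (e \in E).
by have := subsetP EV e eE; rewrite inE => ->; rewrite andbT.
Qed.

Lemma set_pedges_card (x : T) s : uniq (x :: s) -> #|[set e in pedges (x :: s)]| = size s.
Proof. by move=> us; rewrite cardsE (card_uniqP (uniq_pedges us)) size_pedges. Qed.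

Lemma pedges_sub (s : seq T) e : e \in pedges s -> e \subset [set z in s].
Proof.
elim: s => [|x [|y s] IH] //; rewrite pedges_cons2 inE => /orP[/eqP->|/IH h].
  by rewrite subUset !sub1set !inE !eqxx orbT.
by apply: subset_trans h _; apply/subsetP => z; rewrite !inE => ->; rewrite orbT.
Qed.

Lemma pedges_vpairs (s : seq T) : uniq s -> [set e in pedges s] \subset vpairs T.
Proof.
move=> us; apply/subsetP => e; rewrite inE; elim: s us => [|x [|y s] IH] // /andP[xs us].
rewrite pedges_cons2 inE => /orP[/eqP->|]; last exact: IH.
rewrite inE cards2 eqSS eqb1; apply: contraNneq xs => ->; exact: mem_head.
Qed.

End Between.

(** * Probabilities of the atypical events, and the second moment of the number of low degrees *)

Section Events.
Variables (R : realType) (n : nat) (p : R).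
Hypothesis p01 : 0 <= p <= 1.
Local Notation T := 'I_n.
Local Notation V := (vpairs T).
Implicit Types (E Q Z W G H : {set {set T}}).

Lemma disjoint0 (J : finType) (E : {set J}) : [disjoint set0 & E].
Proof. by rewrite disjoints_subset sub0set. Qed.

Lemma expected_growth (W : {set {set T}}) (x : R) : W \subset V ->
  gnp_exp p (fun E => x ^+ #|E :&: W|) = (1 - p + p * x) ^+ #|W|.
Proof.
move=> WV; have := @gnp_exp_pattern R n p set0 set0 W x.
rewrite !sub0set !disjoint0 WV !cards0 !expr0 !mul1r => /(_ isT isT isT isT isT isT) <-.
by apply: eq_bigr => E _; rewrite sub0set disjoint_sym disjoint0 !mul1r.
Qed.

Lemma expected_path_growth Q W (x : R) : Q \subset V -> W \subset V -> [disjoint Q & W] ->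
  gnp_exp p (fun E => (Q \subset E)%:R * x ^+ #|E :&: W|) =
  p ^+ #|Q| * (1 - p + p * x) ^+ #|W|.
Proof.
move=> QV WV QW; have := @gnp_exp_pattern R n p Q set0 W x.
rewrite sub0set [[disjoint Q & set0]]disjoint_sym !disjoint0 WV QV QW cards0 expr0 mulr1.
move=> /(_ isT isT isT isT isT isT) <-.
by apply: eq_bigr => E _; rewrite [[disjoint E & _]]disjoint_sym disjoint0 mulr1.
Qed.

Definition close_pair E (k l : nat) := `[< exists v s, [/\ uniq (v :: s), size s = l,
  path (adj E) v s, (degree E v <= k)%N & (degree E (last v s) <= k)%N] >].

Lemma gnp_close_pair (k l : nat) (x : R) : 0 < x <= 1 -> (0 < l)%N ->
  gnp_prob p (fun E => close_pair E k l) <=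
  (n ^ l.+1)%:R * ((x ^+ (2 * k))^-1 * (p ^+ l * (1 - p + p * x) ^+ (2 * (n - l.+1)))).
Proof.
move=> /andP[x0 x1] l0.
pose Q (j : T * l.-tuple T) := [set e in pedges (j.1 :: j.2)].
(* Only pairs leaving the path are counted, so [W] is disjoint from the path edges [Q]. The two end
   degrees still bound the number of edges in [W] by [2 * k]. *)
pose W (j : T * l.-tuple T) :=
  between [set j.1; last j.1 j.2] (~: [set z in j.1 :: j.2]).
pose f (j : T * l.-tuple T) E : R :=
  (x ^+ (2 * k))^-1 * ((Q j \subset E)%:R * x ^+ #|E :&: W j|).
have xk0 m : 0 < x ^+ m by apply: exprn_gt0.
have dW (j : T * l.-tuple T) : [disjoint [set j.1; last j.1 j.2] & ~: [set z in j.1 :: j.2]].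
  by rewrite disjoints_subset setCK subUset !sub1set !inE eqxx -in_cons mem_last.
have lastne (j : T * l.-tuple T) : uniq (j.1 :: j.2) -> j.1 != last j.1 j.2.
  case: j => v [[|y s] sl] /=; first by move: sl l0; rewrite eq_sym => /eqP->.
  by case/andP=> vs _; apply: contraNneq vs => ->; apply: mem_last.
apply: (le_trans (@gnp_union R n p p01 _ (fun j : T * l.-tuple T => uniq (j.1 :: j.2)) f _ _ _)).
- move=> j E; apply: mulr_ge0; first by rewrite invr_ge0 ltW.
  by apply: mulr_ge0; rewrite ?ler0n // ltW.
- move=> E EV /asboolP[v [s [us sl ps dv dl]]].
  have sP : size s == l by apply/eqP.
  exists (v, Tuple sP) => //; rewrite /f.
  have -> : Q (v, Tuple sP) \subset E.
    by apply/subsetP => e; rewrite inE; apply: pedges_path ps e.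
  rewrite mul1r mulrC ler_pdivlMr // mul1r; apply: ler_wiXn2l => //; first exact: ltW.
  apply: leq_trans (card_between_le _ _ _) _ => /=.
  have vl := lastne (v, Tuple sP) us.
  by rewrite big_setU1 ?inE //= big_set1 mul2n -addnn leq_add.
have cst (j : T * l.-tuple T) : uniq (j.1 :: j.2) -> gnp_exp p (f j) =
    (x ^+ (2 * k))^-1 * (p ^+ l * (1 - p + p * x) ^+ (2 * (n - l.+1))).
  move=> uj; rewrite /f gnp_expZ expected_path_growth.
  - congr (_ * (_ ^+ _ * _ ^+ _)); first by rewrite set_pedges_card // size_tuple.
    rewrite card_between // cards2 (lastne _ uj) cardsCs setCK card_ord.
    by rewrite cardsE (card_uniqP uj) /= size_tuple.
  - exact: pedges_vpairs.
  - exact: between_vpairs.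
  - apply/pred0P => e /=; apply/negP => /andP[]; rewrite inE => /pedges_sub/subsetP h.
    case/imset2P => a b _; rewrite inE => bS eE; case/negP: bS; apply: h.
    by rewrite eE set22.
case/andP: p01 => p0 p1.
have c0 : 0 <= (x ^+ (2 * k))^-1 * (p ^+ l * (1 - p + p * x) ^+ (2 * (n - l.+1))).
  apply: mulr_ge0; first by rewrite invr_ge0 ltW.
  apply: mulr_ge0; apply: exprn_ge0 => //.
  by apply: addr_ge0; [rewrite subr_ge0 | apply: mulr_ge0 => //; apply: ltW].
rewrite (eq_bigr _ cst); set c := _ * _ in c0 *.
apply: le_trans (_ : \sum_(j : T * l.-tuple T) c <= _).
  by rewrite [X in X <= _]big_mkcond /=; apply: ler_sum => j _; case: ifP.
by rewrite sumr_const card_prod card_tuple card_ord -expnS mulr_natl.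
Qed.

(** The tilt is [y ^+ 14] per edge, so that no quotient of [D * #|S|] by 14 is needed. *)
Lemma gnp_not_sparse (D s0 : nat) (y : R) : 1 <= y ->
  gnp_prob p (fun E => [exists S : {set T}, (0 < #|S| <= s0)%N &&
    (D * #|S| <= 14 * #|[set e in E | e \subset S]|)%N]) <=
  \sum_(S : {set T} | (0 < #|S| <= s0)%N)
    (y ^+ (D * #|S|))^-1 * (1 - p + p * y ^+ 14) ^+ 'C(#|S|, 2).
Proof.
move=> y1; have y0 : 0 < y by apply: lt_le_trans y1.
pose f (S : {set T}) E : R := (y ^+ (D * #|S|))^-1 * (y ^+ 14) ^+ #|E :&: inner_pairs S|.
apply: (le_trans (@gnp_union R n p p01 _ (fun S : {set T} => (0 < #|S| <= s0)%N) f _ _ _)).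
- move=> S E; apply: mulr_ge0; first by rewrite invr_ge0 exprn_ge0 // ltW.
  by rewrite !exprn_ge0 // ltW.
- move=> E EV /existsP[S /andP[S0 hS]]; exists S => //.
  rewrite /f -exprM mulrC ler_pdivlMr ?exprn_gt0 // mul1r.
  by rewrite -(inner_edges _ EV); apply: ler_weXn2l.
apply: ler_sum => S _; rewrite /f gnp_expZ expected_growth ?card_inner_pairs //.
exact: inner_pairs_vpairs.
Qed.

Lemma gnp_not_dense (kd g w : nat) (x : R) : 0 < x <= 1 ->
  gnp_prob p (fun E => [exists AB : {set T} * {set T},
    [&& [disjoint AB.1 & AB.2], (g <= #|AB.1|)%N, (n <= 4 * #|AB.2|)%N &
     (#|E :&: between AB.1 AB.2| < w + kd * #|AB.1|)%N]]) <=
  \sum_(AB : {set T} * {set T} | [&& [disjoint AB.1 & AB.2], (g <= #|AB.1|)%N &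
     (n <= 4 * #|AB.2|)%N])
    (x ^+ (w + kd * #|AB.1|))^-1 * (1 - p + p * x) ^+ (#|AB.1| * #|AB.2|).
Proof.
move=> /andP[x0 x1].
pose f (AB : {set T} * {set T}) E : R :=
  (x ^+ (w + kd * #|AB.1|))^-1 * x ^+ #|E :&: between AB.1 AB.2|.
apply: (le_trans (@gnp_union R n p p01 _ (fun AB : {set T} * {set T} =>
   [&& [disjoint AB.1 & AB.2], (g <= #|AB.1|)%N & (n <= 4 * #|AB.2|)%N]) f _ _ _)).
- move=> j E; apply: mulr_ge0; first by rewrite invr_ge0 exprn_ge0 // ltW.
  by rewrite exprn_ge0 // ltW.
- move=> E EV /existsP[AB /and4P[dAB gA nB lt]]; exists AB; first by rewrite dAB gA nB.
  rewrite /f mulrC ler_pdivlMr ?exprn_gt0 // mul1r.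
  by apply: ler_wiXn2l => //; [apply: ltW | apply: ltnW].
apply: ler_sum => AB /and3P[dAB _ _].
by rewrite /f gnp_expZ expected_growth ?card_between // between_vpairs.
Qed.

Lemma gnp_many_edges (M : nat) :
  gnp_prob p (fun E => (M < #|E|)%N) <= (2 ^+ M)^-1 * (1 + p) ^+ 'C(n, 2).
Proof.
pose f (j : unit) E : R := (2 ^+ M)^-1 * 2 ^+ #|E :&: V|.
have e2 m : 0 < (2 : R) ^+ m by rewrite exprn_gt0.
apply: (le_trans (@gnp_union R n p p01 _ xpredT f _ _ _)).
- by move=> j E; apply: mulr_ge0; rewrite ?invr_ge0 ltW.
- move=> E EV ME; exists tt => //; rewrite /f (setIidPl EV) mulrC ler_pdivlMr // mul1r.
  by apply: ler_weXn2l; [rewrite ler1n | apply: ltnW].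
rewrite (bigD1 tt) //= big1 ?addr0; last by case.
rewrite /f gnp_expZ expected_growth // card_vpairs card_ord.
by rewrite (_ : 1 - p + p * 2 = 1 + p) //; ring.
Qed.

(** For a fixed pair, the edges [Q] of [G] and [H] are present and the boosters [Z] outside [Q] are
    all absent; these events are independent and [#|Z|] is at least [n ^ 2 / 32 - m]. To sum over
    the pairs, [p ^+ #|Q|] is bounded by [x ^- m * (p * x) ^+ #|Q|]. The size restriction can then
    be dropped and the sum becomes a full binomial expansion for each of [G] and [H]. *)
Lemma gnp_no_booster (m : nat) (x : R) : 0 < x <= 1 ->
  gnp_prob p (fun E => [exists GH : {set {set T}} * {set {set T}},
    [&& GH.1 \subset E, GH.2 \subset E, [disjoint GH.1 & GH.2],
        (#|GH.1| + #|GH.2| <= m)%N, (n ^ 2 <= 32 * #|boosters GH.1|)%N &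
        [disjoint boosters GH.1 & E :\: GH.2]]]) <=
  (1 - p) ^+ (n ^ 2 %/ 32 - m) * ((x ^+ m)^-1 * (1 + p * x) ^+ (2 * 'C(n, 2))).
Proof.
move=> /andP[x0 x1]; case/andP: (p01) => p0 p1.
pose P (GH : {set {set T}} * {set {set T}}) :=
  [&& GH.1 \subset V, GH.2 \subset V, [disjoint GH.1 & GH.2],
        (#|GH.1| + #|GH.2| <= m)%N & (n ^ 2 <= 32 * #|boosters GH.1|)%N].
pose Q (GH : {set {set T}} * {set {set T}}) := GH.1 :|: GH.2.
pose Z (GH : {set {set T}} * {set {set T}}) := boosters GH.1 :\: Q GH.
pose f (GH : {set {set T}} * {set {set T}}) E : R :=
  (Q GH \subset E)%:R * [disjoint E & Z GH]%:R * 1 ^+ #|E :&: set0|.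
have c0 : 0 <= (1 - p) ^+ (n ^ 2 %/ 32 - m) by rewrite exprn_ge0 // subr_ge0.
apply: (le_trans (@gnp_union R n p p01 _ P f _ _ _)).
- by move=> j E; rewrite /f !mulr_ge0 ?ler0n // expr1n.
- move=> E EV /existsP[GH /and5P[GE HE dGH cGH /andP[bG dB]]]; exists GH.
    by rewrite /P dGH cGH bG !(subset_trans _ EV).
  rewrite /f expr1n mulr1 /Q subUset GE HE mul1r.
  suff -> : [disjoint E & Z GH] by [].
  apply/pred0P => e /=; apply/negP => /andP[eE]; rewrite !inE negb_or.
  case/and3P=> /andP[_ eH] ev eB.
  have eBB : e \in boosters GH.1 by rewrite !inE ev eB.
  by have := disjointFr dB eBB; rewrite inE eH eE.
apply: (@le_trans _ _ (\sum_(GH | P GH)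
   (1 - p) ^+ (n ^ 2 %/ 32 - m) * ((x ^+ m)^-1 * ((p * x) ^+ #|GH.1| * (p * x) ^+ #|GH.2|)))).
  apply: ler_sum => GH /and5P[GV HV dGH cGH bG].
  have cQ : #|Q GH| = (#|GH.1| + #|GH.2|)%N.
    by rewrite /Q cardsU (disjoint_setI0 dGH) cards0 subn0.
  have ZV : Z GH \subset V.
    by apply: subset_trans (subsetDl _ _) _; apply/subsetP => e; rewrite !inE => /andP[].
  have := @gnp_exp_pattern R n p (Q GH) (Z GH) set0 1.
  rewrite ZV sub0set ![[disjoint _ & set0]]disjoint_sym !disjoint0 subUset GV HV.
  rewrite disjoint_sym -/(f GH) => -> //; last first.
    by apply/pred0P => e /=; rewrite inE; case: (e \in Q GH); rewrite ?andbF.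
  rewrite cards0 expr0 mulr1 mulrC; apply: ler_pM.
  - by rewrite exprn_ge0 // subr_ge0.
  - by rewrite exprn_ge0.
  - apply: ler_wiXn2l; [by rewrite subr_ge0 | by rewrite lerBlDr lerDl |].
    have h1 : (n ^ 2 %/ 32 <= #|boosters GH.1|)%N.
      by apply: leq_trans (leq_div2r 32 bG) _; rewrite mulnC mulnK.
    have h2 : (#|boosters GH.1| <= #|Z GH| + #|Q GH|)%N.
      rewrite -(cardsID (Q GH) (boosters GH.1)) addnC leq_add2l.
      exact/subset_leq_card/subsetIr.
    rewrite leq_subLR; apply: leq_trans h1 _; apply: leq_trans h2 _.
    by rewrite addnC leq_add2r cQ.
  rewrite -exprD -cQ exprMn mulrC -mulrA ler_peMr ?exprn_ge0 //.
  rewrite ler_pdivlMr ?exprn_gt0 // mul1r; apply: ler_wiXn2l => //; first exact: ltW.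
  by rewrite cQ.
rewrite -big_distrr /= -big_distrr /=; apply: ler_wpM2l => //; apply: ler_wpM2l.
  by rewrite invr_ge0 exprn_ge0 // ltW.
have px0 : 0 <= p * x by apply: mulr_ge0 => //; apply: ltW.
apply: (@le_trans _ _ (\sum_(G : {set {set T}} | G \subset V)
    \sum_(H : {set {set T}} | H \subset V) (p * x) ^+ #|G| * (p * x) ^+ #|H|)).
  rewrite pair_big /= [X in X <= _]big_mkcond [X in _ <= X]big_mkcond /=.
  apply: ler_sum => GH _; rewrite /P; case: ifPn => [/and5P[-> -> _ _ _]//|_].
  by case: ifP => _ //; rewrite mulr_ge0 ?exprn_ge0.
under eq_bigr do rewrite -big_distrr sum_subsets_exp /=.
rewrite -big_distrl /= sum_subsets_exp -exprD card_vpairs card_ord.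
by rewrite addnn mul2n.
Qed.

Lemma gnp_atypical (kd k1 D g w M m : nat) :
  gnp_prob p (fun E => ~~ `[< typical E kd k1 D g w M m >]) <=
  \sum_(l < 4) gnp_prob p (fun E => close_pair E k1 l.+1) +
  gnp_prob p (fun E => [exists S : {set T}, (0 < #|S| <= 7 * g)%N &&
    (D * #|S| <= 14 * #|[set e in E | e \subset S]|)%N]) +
  gnp_prob p (fun E => [exists AB : {set T} * {set T},
    [&& [disjoint AB.1 & AB.2], (g <= #|AB.1|)%N, (n <= 4 * #|AB.2|)%N &
     (#|E :&: between AB.1 AB.2| < w + kd * #|AB.1|)%N]]) +
  gnp_prob p (fun E => (M < #|E|)%N) +
  gnp_prob p (fun E => [exists GH : {set {set T}} * {set {set T}},
    [&& GH.1 \subset E, GH.2 \subset E, [disjoint GH.1 & GH.2],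
        (#|GH.1| + #|GH.2| <= m)%N, (n ^ 2 <= 32 * #|boosters GH.1|)%N &
        [disjoint boosters GH.1 & E :\: GH.2]]]).
Proof.
set P2 := (X in _ + gnp_prob p X + _ + _ + _).
set P3 := (X in _ + gnp_prob p X + _ + _).
set P4 := (X in _ + gnp_prob p X + _).
set P5 := (X in _ + gnp_prob p X).
have U := gnp_probU p01.
have hU : gnp_prob p (fun E => [exists l : 'I_4, close_pair E k1 l.+1] ) <=
    \sum_(l < 4) gnp_prob p (fun E => close_pair E k1 l.+1).
  under [X in _ <= X]eq_bigr do rewrite gnp_prob_exp.
  apply: (@gnp_union R n p p01 _ xpredT (fun l : 'I_4 => fun E => (close_pair E k1 l.+1)%:R)).
    by move=> l E; rewrite ler0n.
  by move=> E _ /existsP[l hl]; exists l; rewrite // hl.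
pose P1 E := [exists l : 'I_4, close_pair E k1 l.+1].
apply: (@le_trans _ _ (gnp_prob p (fun E => (((P1 E || P2 E) || P3 E) || P4 E) || P5 E)));
  last first.
  apply: (le_trans (U n (fun E => ((P1 E || P2 E) || P3 E) || P4 E) P5)); apply: lerD => //.
  apply: (le_trans (U n (fun E => (P1 E || P2 E) || P3 E) P4)); apply: lerD => //.
  apply: (le_trans (U n (fun E => P1 E || P2 E) P3)); apply: lerD => //.
  by apply: (le_trans (U n P1 P2)); apply: lerD.
apply: gnp_prob_le => // E EV; apply: contraR; rewrite !negb_or -!andbA.
case/and5P=> /existsPn h1 /existsPn h2 /existsPn h3 h4 /existsPn h5.
apply/asboolP; split.
- move=> x s us /andP[s0 s4] ps dx dl.
  have ls : ((size s).-1 < 4)%N by case: (size s) s0 s4.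
  have /negP := h1 (Ordinal ls); apply; apply/asboolP; exists x, s; split=> //=.
  by rewrite prednK.
- by move=> S hS; have := h2 S; rewrite hS /= -ltnNge.
- move=> A B dAB gA; rewrite card_ord => nB.
  by have := h3 (A, B); rewrite /= dAB gA nB /= -leqNgt.
- by move: h4; rewrite /P4 -leqNgt.
move=> G H GE HE dGH cGH; rewrite card_ord => bG.
have := h5 (G, H); rewrite /= GE HE dGH cGH bG /= => /pred0Pn[e /= /andP[eB eE]].
by exists e.
Qed.

(** The probability that a binomial variable with parameters [N] and [p] is at most [k]. *)
Definition binomial_tail (N k : nat) : R :=
  \sum_(j < k.+1) 'C(N, j)%:R * (p ^+ j * (1 - p) ^+ (N - j)).

Lemma sum_small_subsets (D : {set {set T}}) (k : nat) :
  \sum_(S : {set {set T}} | (S \subset D) && (#|S| <= k)%N) p ^+ #|S| * (1 - p) ^+ #|D :\: S| =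
  binomial_tail #|D| k.
Proof.
transitivity (\sum_(S : {set {set T}} | S \subset D) \sum_(j < k.+1 | j == #|S| :> nat)
    p ^+ j * (1 - p) ^+ (#|D| - j)).
  rewrite big_mkcondr /=; apply: eq_bigr => S SD; case: leqP => hS.
    rewrite (big_pred1 (Ordinal (hS : (#|S| < k.+1)%N))) /= ?cardsDS //.
  by rewrite big1 // => j /eqP jS; have := ltn_ord j; rewrite jS ltnS leqNgt hS.
rewrite (exchange_big_dep xpredT) //= /binomial_tail; apply: eq_bigr => j _.
rewrite sumr_const mulr_natl; congr (_ *+ _).
rewrite -cards_draws -[RHS]cardsE; apply: eq_card => S; rewrite !inE.
by rewrite eq_sym.
Qed.

(** Independence of disjoint sets of pairs. Each indicator is expanded over the possible traces [S]
    of [E] on the set, and every term is then a pattern with prescribed present and absent edges. *)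
Lemma gnp_exp_two_tails (D D' : {set {set T}}) (k k' : nat) :
  D \subset V -> D' \subset V -> [disjoint D & D'] ->
  gnp_exp p (fun E => (#|E :&: D| <= k)%N%:R * (#|E :&: D'| <= k')%N%:R) =
  binomial_tail #|D| k * binomial_tail #|D'| k'.
Proof.
move=> DV D'V dD.
have tailE (F : {set {set T}}) l E :
    (#|E :&: F| <= l)%N%:R = \sum_(S : {set {set T}} | (S \subset F) && (#|S| <= l)%N)
      (S \subset E)%:R * [disjoint E & F :\: S]%:R :> R.
  have key (S : {set {set T}}) : S \subset F ->
      (S \subset E)%:R * [disjoint E & F :\: S]%:R = (S == E :&: F)%:R :> R.
    move=> SF; rewrite -natrM mulnb; congr ((nat_of_bool _)%:R).
    apply/andP/eqP => [[SE dE]|->].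
      apply/eqP; rewrite eqEsubset subsetI SE SF /=; apply/subsetP => e /setIP[eE eF].
      by apply: contraT => eS; have := disjointFr dE eE; rewrite inE eS eF.
    split; first exact: subsetIl.
    by apply/pred0P => e /=; rewrite !inE; case: (e \in E); case: (e \in F).
  rewrite (eq_bigr (fun S => (S == E :&: F)%:R)); last by move=> S /andP[/key].
  case: leqP => hl.
    rewrite (bigD1 (E :&: F)) /=; last by rewrite subsetIr.
    by rewrite eqxx big1 ?addr0 // => S /andP[_ /negPf->].
  rewrite big1 // => S /andP[_ hS]; case: eqP => // ES.
  by move: hS; rewrite ES leqNgt hl.
transitivity (gnp_exp p (fun E =>
  \sum_(S : {set {set T}} | (S \subset D) && (#|S| <= k)%N)
  \sum_(S' : {set {set T}} | (S' \subset D') && (#|S'| <= k')%N)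
   ((S :|: S') \subset E)%:R * [disjoint E & (D :\: S) :|: (D' :\: S')]%:R * 1 ^+ #|E :&: set0|)).
  apply: eq_bigr => E _; congr (_ * _); rewrite (tailE D) (tailE D') big_distrl /=.
  apply: eq_bigr => S _; rewrite big_distrr /=; apply: eq_bigr => S' _.
  rewrite expr1n mulr1 subUset.
  have -> : [disjoint E & (D :\: S) :|: (D' :\: S')] =
      [disjoint E & D :\: S] && [disjoint E & D' :\: S'].
    by rewrite !disjoints_subset setCU subsetI.
  by rewrite -!mulnb !natrM mulrACA.
rewrite gnp_exp_sum -!sum_small_subsets big_distrl /=.
apply: eq_bigr => S /andP[SD _]; rewrite gnp_exp_sum big_distrr /=.
apply: eq_bigr => S' /andP[SD' _].
have dSS : [disjoint S & S'] by apply: disjointWl SD _; apply: disjointWr SD' _.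
have dDD : [disjoint D :\: S & D' :\: S'].
  by apply: disjointWl (subsetDl _ _) _; apply: disjointWr (subsetDl _ _) _.
rewrite gnp_exp_pattern ?sub0set //; first last.
- by rewrite disjoint_sym disjoint0.
- by rewrite disjoint_sym disjoint0.
- apply/pred0P => e /=; apply/negP; rewrite !inE.
  case/andP=> /orP[] eS /orP[] /andP[h1 h2]; first by rewrite eS in h1.
  + by have := disjointFr dD (subsetP SD _ eS); rewrite h2.
  + by have := disjointFl dD (subsetP SD' _ eS); rewrite h2.
  + by rewrite eS in h1.
- by rewrite subUset !(subset_trans (subsetDl _ _)).
- by rewrite subUset (subset_trans SD) // (subset_trans SD').
rewrite cards0 expr0 mulr1 !cardsU (disjoint_setI0 dSS) (disjoint_setI0 dDD) cards0 !subn0.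
by rewrite !exprD mulrACA.
Qed.

(** Chebyshev's inequality for the number [X] of vertices of degree at most [k]. Two degrees share a
    single pair, so the correlation costs only the factor [(1 - p) ^- 2]. *)
Lemma gnp_min_degree_gt (k : nat) : (1 < n)%N -> p < 1 -> 0 < binomial_tail (n - 2) k ->
  gnp_prob p (fun E => (k < min_degree E)%N) <=
  (n%:R * (1 - p) * binomial_tail (n - 2) k)^-1 + ((1 - p) ^+ 2)^-1 - 1.
Proof.
move=> n1 p1 q0; set q := binomial_tail _ _ in q0 *.
have p1' : 0 < 1 - p by rewrite subr_gt0.
pose X E : R := \sum_(v : T) (degree E v <= k)%N%:R.
pose mu := gnp_exp p X.
(* The pairs at [u] other than [uv]: without the shared pair the counts at [u] and at [v] are
   independent. *)
pose D (u v : T) := between [set u] (~: [set u; v]).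
have DV u v : D u v \subset V by apply: between_vpairs; rewrite disjoints_subset setCK sub1set set21.
have cD u v : u != v -> #|D u v| = (n - 2)%N.
  move=> uv; rewrite card_between ?disjoints_subset ?setCK ?sub1set ?set21 //.
  by rewrite cards1 mul1n cardsCs setCK cards2 uv card_ord.
have DE u v E : (#|E :&: D u v| <= degree E u)%N.
  by apply: leq_trans (card_between_le _ _ _) _; rewrite big_set1.
have ED u v E : u != v -> E \subset V -> (degree E u <= #|E :&: D u v| + #|E :&: [set [set u; v]]|)%N.
  move=> uv EV.
  apply: leq_trans (_ : #|(E :&: D u v) :|: (E :&: [set [set u; v]])| <= _)%N.
    apply/subset_leq_card/subsetP => e; rewrite inE => /andP[eE ue].
    have [y yu eE'] := vpairsP EV eE ue; rewrite !inE eE /=.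
    have [yv|yv] := eqVneq y v; first by rewrite eE' yv eqxx orbT.
    apply/orP; left; apply/imset2P; exists u y; rewrite ?inE ?eqxx //.
    by rewrite negb_or yu.
  exact: leq_card_setU.
(* For any [v] other than [u], the degree of [u] is at most [k] when [uv] is absent and [D u v] has
   at most [k] edges. Absence of [uv] is the tail with bound 0 on a single pair. *)
have muq : n%:R * ((1 - p) * q) <= mu.
  rewrite /mu /X gnp_exp_sum mulr_natl -[X in _ *+ X]card_ord -sumr_const.
  apply: ler_sum => u _.
  have [v uv] : exists v : T, u != v.
    have : (0 < #|[set~ u]|)%N by rewrite cardsC1 card_ord; lia.
    by case/card_gt0P => v; rewrite !inE eq_sym; exists v.
  have t1 : binomial_tail #|[set [set u; v]]| 0 = 1 - p.
    by rewrite cards1 /binomial_tail big_ord1 bin0 expr0 !mul1r.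
  have := @gnp_exp_two_tails (D u v) [set [set u; v]] k 0 (DV u v).
  rewrite t1 cD // -/q mulrC => <-; last 2 first.
  - by rewrite sub1set inE cards2 uv.
  - rewrite disjoint_sym disjoints1; apply/imset2P => -[a b]; rewrite !inE => /eqP-> bv.
    by case/eq_set2 => [[_ vb]|[ub _]]; move: bv; rewrite ?vb ?ub eqxx ?orbT.
  apply: gnp_exp_le => // E EV; rewrite -natrM mulnb ler_nat.
  have h3 := ED u v E uv EV; case: andP => //= -[h1 h2].
  by rewrite (leq_trans h3) // -[k]addn0 leq_add.
have mu0 : 0 < mu by apply: lt_le_trans muq; rewrite !mulr_gt0 // ltr0n; lia.
have X2 : gnp_exp p (fun E => X E * X E) <= mu + n%:R ^+ 2 * q ^+ 2.
  apply: (@le_trans _ _ (gnp_exp p (fun E => X E + \sum_(u : T) \sum_(v : T | v != u)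
     ((#|E :&: D u v| <= k)%N%:R * (#|E :&: D v u| <= k)%N%:R)))).
    apply: gnp_exp_le => // E EV; rewrite {1}/X big_distrl /X /= -big_split /=.
    apply: ler_sum => u _; rewrite (bigD1 u) //= mulrDr; apply: lerD.
      by case: (_ <= _)%N; rewrite ?mulr1 ?mulr0.
    rewrite big_distrr /=; apply: ler_sum => v _.
    rewrite -!natrM ler_nat !mulnb.
    case: (leqP (degree E u) k) => //= hu; case: (leqP (degree E v) k) => //= hv.
    by rewrite !(leq_trans (DE _ _ _)).
  rewrite (gnp_expD p X) lerD2l gnp_exp_sum.
  apply: (@le_trans _ _ (\sum_(u : T) \sum_(v : T) q ^+ 2)).
    apply: ler_sum => u _; rewrite gnp_exp_sum big_mkcond /=; apply: ler_sum => v _.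
    case: ifPn => [vu|_]; last by rewrite exprn_ge0 // ltW.
    rewrite gnp_exp_two_tails // ?cD // ?(eq_sym u) //.
    apply/pred0P => e /=; apply/negP => /andP[].
    case/imset2P => a b; rewrite !inE => /eqP-> bu ->.
    case/imset2P => c d; rewrite !inE => /eqP-> dv /eq_set2[[uv _]|[_ bv]].
      by rewrite uv eqxx in vu.
    by rewrite bv eqxx orbT in bu.
  by rewrite !sumr_const card_ord -mulrnA -natrX mulr_natl mulnn.
(* When the minimum degree exceeds [k], [X E] is 0 and this weight equals 1. *)
pose f (j : unit) E : R := (mu ^+ 2)^-1 * (X E - mu) ^+ 2.
apply: (le_trans (@gnp_union R n p p01 _ xpredT f _ _ _)).
- by move=> j E; rewrite mulr_ge0 ?invr_ge0 ?sqr_ge0.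
- move=> E EV kE; exists tt => //; rewrite /f.
  have -> : X E = 0.
    by apply: big1 => v _; rewrite leqNgt (leq_trans kE (min_degree_le E v)).
  by rewrite sub0r sqrrN mulVf // expf_neq0 // gt_eqF.
rewrite (bigD1 tt) //= big1 ?addr0; last by case.
rewrite /f gnp_expZ.
have -> : gnp_exp p (fun E => (X E - mu) ^+ 2) = gnp_exp p (fun E => X E * X E) - mu ^+ 2.
  transitivity (gnp_exp p (fun E => X E * X E + (- (2 * mu) * X E + mu ^+ 2 * 1))).
    by apply: eq_bigr => E _; congr (_ * _); ring.
  rewrite (gnp_expD p (fun E => X E * X E)) (gnp_expD p (fun E => - (2 * mu) * X E)).
  by rewrite !gnp_expZ gnp_exp1 -/mu; ring.
apply: (@le_trans _ _ ((mu ^+ 2)^-1 * (mu + n%:R ^+ 2 * q ^+ 2 - mu ^+ 2))).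
  by apply: ler_wpM2l; [rewrite invr_ge0 sqr_ge0 | rewrite lerD2r].
have -> : (mu ^+ 2)^-1 * (mu + n%:R ^+ 2 * q ^+ 2 - mu ^+ 2) =
   mu^-1 + (n%:R * q / mu) ^+ 2 - 1 by field; rewrite gt_eqF.
rewrite lerD2r; apply: lerD.
  by rewrite lef_pV2 ?posrE // -?mulrA // !mulr_gt0 // ltr0n; lia.
rewrite -exprVn ler_sqr ?nnegrE ?invr_ge0 ?(ltW p1') //; last first.
  by rewrite !mulr_ge0 ?ler0n ?invr_ge0 ?ltW.
rewrite ler_pdivrMr // [_^-1 * _]mulrC ler_pdivlMr //.
by apply: le_trans muq; rewrite mulrAC mulrA.
Qed.

End Events.

(** * Asymptotics *)

Section ExpBounds.
Variable R : realType.
Implicit Types (x u : R).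

Lemma ln2_ge : 3 / 5 <= ln (2 : R).
Proof.
rewrite -ler_expR lnK ?posrE //.
have h1 : 4 / 5 <= expR (- (1 / 5)) :> R by apply: le_trans (expR_ge1Dx _); lra.
have h2 : (4 / 5) ^+ 3 <= expR (- (3 / 5)) :> R.
  have -> : expR (- (3 / 5)) = expR (- (1 / 5)) ^+ 3 :> R.
    by rewrite -expRM_natl; congr expR; lra.
  by apply: lerXn2r; rewrite ?nnegrE ?expR_ge0 //; lra.
have : expR (3 / 5) * expR (- (3 / 5)) = 1 :> R by apply: expRxMexpNx_1.
have := expR_gt0 (3 / 5 : R); move: h2; rewrite !exprS expr0.
set e := expR _; set f := expR _ => h2 f0 ef.
have : f * (1 / 2) <= f * e by rewrite ler_pM2l //; lra.
by rewrite ef; lra.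
Qed.

Lemma ln2_le : ln (2 : R) <= 3 / 4.
Proof.
rewrite -ler_expR lnK ?posrE //.
have h1 : 35 / 32 <= expR (3 / 32) :> R by apply: le_trans (expR_ge1Dx _); lra.
have -> : expR (3 / 4) = expR (3 / 32) ^+ 8 :> R.
  by rewrite -expRM_natl; congr expR; lra.
apply: (@le_trans _ _ ((35 / 32) ^+ 8)); last by apply: lerXn2r; rewrite ?nnegrE ?expR_ge0 //; lra.
rewrite !exprS expr0; lra.
Qed.

Lemma pow_expR x k : 0 < x -> x ^+ k = expR (k%:R * ln x).
Proof. by move=> x0; rewrite expRM_natl lnK. Qed.

Lemma pow_le_expR u k : 0 <= 1 + u -> (1 + u) ^+ k <= expR (k%:R * u).
Proof.
move=> u0; rewrite expRM_natl; apply: lerXn2r; rewrite ?nnegrE ?expR_ge0 //.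
exact: expR_ge1Dx.
Qed.

Lemma pow_ge_expR u k : 0 <= u < 1 -> expR (- (k%:R * (u / (1 - u)))) <= (1 - u) ^+ k.
Proof.
case/andP=> u0 u1; have v0 : 0 < 1 - u by rewrite subr_gt0.
rewrite expRN -[X in _ <= X]invrK lef_pV2 ?posrE ?invr_gt0 ?expR_gt0 ?exprn_gt0 //.
have e1 : (1 - u)^-1 = 1 + u / (1 - u) by field; rewrite gt_eqF.
rewrite -exprVn [X in X ^+ k <= _]e1.
by apply: pow_le_expR; rewrite addr_ge0 // divr_ge0 // ltW.
Qed.

Lemma expRN_le_inv x : 0 < x -> expR (- x) <= x^-1.
Proof.
move=> x0; rewrite expRN lef_pV2 ?posrE ?expR_gt0 //.
by apply: le_trans (expR_ge1Dx x); rewrite lerDr.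
Qed.

Lemma expR_sub1_le u : 0 <= u <= 1 / 2 -> expR u - 1 <= 2 * u.
Proof.
case/andP=> u0 u1; have h : 1 - u <= expR (- u) by have := expR_ge1Dx (- u); lra.
have e : expR u * expR (- u) = 1 by apply: expRxMexpNx_1.
have h2 : expR u * (1 - u) <= expR u * expR (- u) by rewrite ler_pM2l ?expR_gt0.
rewrite e in h2.
have h3 : (1 + 2 * u) * (1 - u) >= 1 by nra.
have : expR u * (1 - u) <= (1 + 2 * u) * (1 - u) by apply: le_trans h3.
rewrite ler_pM2r; [lra | lra].
Qed.

Lemma bin2_le n : ('C(n, 2))%:R <= n%:R * n%:R / 2 :> R.
Proof.
rewrite ler_pdivlMr // -natrM -natrM ler_nat bin2 muln2.
apply: leq_trans (_ : n * n.-1 <= _)%N; last by rewrite leq_mul2l leq_pred orbT.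
by rewrite -[X in (_ <= X)%N]odd_double_half leq_addl.
Qed.

(** Induction through [C(n+1, k+1) = (n+1)/(k+1) * C(n, k)], using [(n+1)/(k+1) <= n/k], which is
    [c] below. *)
Lemma bin_ge n k : (k <= n)%N -> n%:R ^+ k <= k%:R ^+ k * ('C(n, k))%:R :> R.
Proof.
move=> kn; rewrite -!natrX -natrM ler_nat.
elim: k n kn => [|k IH] [|n] // kn.
have h := IH n kn; have e := mul_bin_diag n.+1 k.
have c : (n.+1 * k <= n * k.+1)%N by rewrite mulSn mulnS leq_add2r.
have ck : ((n.+1 * k) ^ k <= (n * k.+1) ^ k)%N by case: (k) c => // k' c; rewrite leq_exp2r.
case: k => [|k] in IH kn h e c ck *; first by rewrite bin1 !expn1 mul1n.
have k0 : (0 < k.+1 ^ k.+1)%N by rewrite expn_gt0.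
rewrite -(leq_pmul2r k0).
have -> : (k.+2 ^ k.+2 * 'C(n.+1, k.+2) * k.+1 ^ k.+1 =
   k.+2 ^ k.+1 * (n.+1 * (k.+1 ^ k.+1 * 'C(n, k.+1))))%N.
  rewrite [(k.+2 ^ k.+2)%N]expnSr -!mulnA; congr (_ * _)%N.
  by rewrite mulnA -e -!mulnA [('C(_, _) * _)%N]mulnC.
apply: leq_trans (_ : k.+2 ^ k.+1 * (n.+1 * n ^ k.+1) <= _)%N; last first.
  by rewrite leq_mul2l leq_mul2l h !orbT.
rewrite [(n.+1 ^ k.+2)%N]expnS mulnCA -!mulnA leq_mul2l -!expnMn; apply/orP; right.
by rewrite [(k.+2 * n)%N]mulnC.
Qed.

End ExpBounds.

(** * Choice of the parameters and numerical estimates for large [n] *)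

Section Estimates.
Variables (R : realType) (n : nat) (p N L th : R).
Local Notation k3 := (10 * 10 * 10).

Hypothesis NE : N = n%:R.
Hypothesis LE : L = ln N.
(* [th] is the exponential tilt in the first moment bound for dense small sets; it fixes
   the scale [n / (7 th)] up to which sets count as small. *)
Hypothesis thE : th = expR (42 * (10 * k3)).
Hypothesis hL : k3 * (k3 * (k3 * (k3 * th))) <= L.
Hypothesis p0 : 0 <= p.
Hypothesis hi : p * N <= 51 / 50 * L.

Lemma theta_ge1 : 1 <= th.
Proof. by rewrite thE; apply: le_trans (expR_ge1Dx _); lra. Qed.

Lemma L_big : k3 * (k3 * (k3 * k3)) <= L.
Proof. by have := theta_ge1; have := hL; lra. Qed.

Lemma L_inv_gt0 : 0 < L^-1.
Proof. by rewrite invr_gt0; have := L_big; lra. Qed.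

Lemma N_gt0 : 0 < N.
Proof.
rewrite ltNge; apply/negP => n0; have := L_big.
by have : L <= 0; [rewrite LE; apply: ln_le0; lra | lra].
Qed.

Lemma N_exp : N = expR L.
Proof. by rewrite LE lnK // posrE N_gt0. Qed.

Lemma N_big : k3 * (k3 * (L * L)) <= N.
Proof.
have hl := L_big; have := @expR_ge1Dxn R L 3; rewrite -N_exp => /(_ _) h.
have l0 : 0 <= L by lra.
have {}h : L ^+ 4 / 24 <= N by have := h l0; rewrite (_ : 4`!%:R = 24) //; lra.
have e : L ^+ 4 = (L * L) * (L * L) by ring.
have h1 : k3 * k3 * 24 <= L * L by nra.
have h2 : (L * L) * (k3 * k3 * 24) <= (L * L) * (L * L).
  by apply: ler_wpM2l => //; nra.
rewrite e in h; lra.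
Qed.

Lemma N_big1 : k3 * (k3 * L) <= N.
Proof. by have := N_big; have hl := L_big; nra. Qed.

Lemma pL_small : p * L <= 1 / k3.
Proof.
have hl := L_big; have hn := N_big; have l0 : 0 < L by lra.
have h : p * (k3 * (k3 * (L * L))) <= p * N by apply: ler_wpM2l.
have h' := hi; have : L * (p * (k3 * (k3 * L))) <= L * (51 / 50) by lra.
by rewrite ler_pM2l //; lra.
Qed.

Lemma p_small : p <= 1 / k3.
Proof. by have := pL_small; have := L_big; have := p0; nra. Qed.

Lemma expR_le_invL (x : R) : x <= - L -> expR x <= L^-1.
Proof.
move=> h; apply: (@le_trans _ _ (expR (- L))); first by rewrite ler_expR.
by apply: expRN_le_inv; have := L_big; lra.
Qed.

(** Absorbs the polynomial factors of [estimate_close_pair]. The sixth order term of the exponential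
    series exceeds [L ^+ 5] by a factor [L], which swallows the constants. *)
Lemma L4_le : k3 * L ^+ 4 * expR (- (3 / 10 * L)) <= L^-1.
Proof.
have hl := L_big; have l0 : 0 < L by lra.
have := @expR_ge1Dxn R (3 / 10 * L) 5.
have -> : (0 <= 3 / 10 * L) by lra.
move=> /(_ isT); rewrite (_ : (6`!)%:R = 72 * 10 :> R); last by rewrite -natrM.
move=> h.
have h5 : k3 * L ^+ 5 <= expR (3 / 10 * L).
  apply: le_trans h; rewrite exprMn (exprS L 5).
  have : 0 <= L ^+ 5 by rewrite exprn_ge0 // ltW.
  have -> : (3 / 10) ^+ 6 = 729 / (k3 * k3) :> R by rewrite !exprS expr0; lra.
  set z := L ^+ 5 => z0.
  have : (k3 * (k3 * (k3 * k3))) * z <= L * z by apply: ler_wpM2r.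
  lra.
rewrite expRN; set e := expR _ in h5 *; have e0 : 0 < e by apply: expR_gt0.
rewrite ler_pdivrMr // [L^-1 * e]mulrC ler_pdivlMr //.
by move: h5; rewrite [L ^+ 5]exprSr mulrA.
Qed.

(* A vertex of at most this degree is expected since [(1 / 200) * ln (0.95 * 200)] exceeds the amount 0.02 by
   which [p * n / L] may exceed 1. *)
Definition degree_cap := Num.trunc (1 / (2 * (10 * 10)) * L).
Local Notation kd := degree_cap.
Definition small_degree := Num.trunc (1 / (10 * 10) * L).
Local Notation k1 := small_degree.
Definition picked_degree := (Num.trunc (L / (10 * k3))).+1.
Local Notation D := picked_degree.
Definition linear_size := Num.trunc (N / th / 7).
Local Notation g := linear_size.
Definition cut_size := Num.trunc (1 / 20 * (g%:R * L)).
Local Notation w := cut_size.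
Definition edge_cap := Num.trunc (N * L).
Local Notation M := edge_cap.
(* The removed cycles take at most [n L / 400] edges and the picked ones [n L / 10000]
   up to lower order terms. *)
Definition booster_budget := Num.trunc (27 / (10 * k3) * (N * L)).
Local Notation m := booster_budget.
Definition hitting_size := (Num.trunc (4 * (10 * 10) * (th * N))).+1.
Local Notation t := hitting_size.

Lemma L_ge0 : 0 <= L. Proof. by have := L_big; lra. Qed.

Lemma kd_bounds : kd%:R <= 1 / (2 * (10 * 10)) * L < kd%:R + 1.
Proof. by rewrite natr1; apply: truncn_itv; have := L_ge0; lra. Qed.

Lemma k1_bounds : k1%:R <= 1 / (10 * 10) * L < k1%:R + 1.
Proof. by rewrite natr1; apply: truncn_itv; have := L_ge0; lra. Qed.

Lemma D_bounds : L / (10 * k3) < D%:R <= L / (10 * k3) + 1.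
Proof.
have /andP[h1 h2] : (Num.trunc (L / (10 * k3)))%:R <= L / (10 * k3) <
    (Num.trunc (L / (10 * k3))).+1%:R by apply: truncn_itv; have := L_ge0; lra.
by rewrite h2 /D -natr1; lra.
Qed.

Lemma g_bounds : 7 * g%:R <= N / th < 7 * (g%:R + 1).
Proof.
have th1 := theta_ge1; have n0 := N_gt0.
have r0 : 0 <= N / th / 7 by rewrite !divr_ge0 //; lra.
have := truncn_itv r0; rewrite -/g -[g.+1%:R]natr1 => /andP[h1 h2].
by apply/andP; split; lra.
Qed.

Lemma r_theta : N / th * th = N.
Proof. by rewrite divfK // gt_eqF //; have := theta_ge1; lra. Qed.

Lemma g_large : N <= 8 * (th * g%:R).
Proof.
have th1 := theta_ge1; have /andP[_ h] := g_bounds; have e := r_theta.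
have hn := N_big1; have hl := hL.
set r := N / th in e h; have h1 : N < 7 * (g%:R + 1) * th by rewrite -e ltr_pM2r //; lra.
have : 0 <= g%:R :> R by []. lra.
Qed.

Lemma w_bounds : w%:R <= 1 / 20 * (g%:R * L) < w%:R + 1.
Proof.
have : 0 <= g%:R * L by rewrite mulr_ge0 ?L_ge0.
by move=> h; rewrite natr1; apply: truncn_itv; lra.
Qed.

Lemma M_bounds : M%:R <= N * L < M%:R + 1.
Proof. by rewrite natr1; apply: truncn_itv; rewrite mulr_ge0 ?L_ge0 // ltW // N_gt0. Qed.

Lemma m_bounds : m%:R <= 27 / (10 * k3) * (N * L) < m%:R + 1.
Proof.
have : 0 <= N * L by rewrite mulr_ge0 ?L_ge0 // ltW // N_gt0.
by move=> h; rewrite natr1; apply: truncn_itv; lra.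
Qed.

Lemma t_bounds : 4 * (10 * 10) * (th * N) < t%:R <= 4 * (10 * 10) * (th * N) + 1.
Proof.
have th1 := theta_ge1; have n0 := N_gt0.
have r0 : 0 <= 4 * (10 * 10) * (th * N) by rewrite !mulr_ge0 //; lra.
have := truncn_itv r0; rewrite /t -[(Num.trunc _).+1%:R]natr1 => /andP[h1 h2].
by apply/andP; split; lra.
Qed.

(** In units of [L], the choice of the path contributes 1 up to a factor [16 * L ^+ 4], the tilt at
    most [4 * 0.01 * 3/4 = 0.03], and the missing edges at the two ends [-(3/2) * 0.95 = -1.425], up
    to a constant. The sum is below [-0.3]. *)
Lemma estimate_close_pair l : (l < 4)%N -> 19 / 20 * L <= p * N ->
  (n ^ l.+2)%:R * (((1 / 4) ^+ (2 * k1))^-1 *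
    (p ^+ l.+1 * (1 - p + p * (1 / 4)) ^+ (2 * (n - l.+2)))) <= L^-1.
Proof.
move=> l4 lo; have hl := L_big; have ps := p_small; have n0 := N_gt0.
have A : (n ^ l.+2)%:R * p ^+ l.+1 <= expR L * (16 * L ^+ 4).
  rewrite -N_exp natrX -NE exprS -mulrA -exprMn ler_pM2l //.
  apply: (@le_trans _ _ ((2 * L) ^+ l.+1)).
    have h' := hi; have h0 : 0 <= N * p by rewrite mulr_ge0 // ltW.
    by apply: lerXn2r; rewrite ?nnegrE; lra.
  have -> : 16 * L ^+ 4 = (2 * L) ^+ 4 by ring.
  by apply: ler_weXn2l => //; lra.
have B : ((1 / 4) ^+ (2 * k1))^-1 <= expR (3 / (10 * 10) * L).
  rewrite -exprVn (_ : (1 / 4)^-1 = 2 ^+ 2); last by field.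
  rewrite -exprM pow_expR // ler_expR !natrM.
  have h : k1%:R * ln 2 <= k1%:R * (3 / 4) :> R by rewrite ler_wpM2l // ln2_le.
  have /andP[] := k1_bounds; lra.
have C : (1 - p + p * (1 / 4)) ^+ (2 * (n - l.+2)) <= expR (- (57 / 40 * L) + 1).
  rewrite (_ : 1 - p + p * (1 / 4) = 1 + (- (3 / 4 * p))); last by field.
  apply: le_trans (pow_le_expR _ _) _; first by lra.
  rewrite ler_expR natrM.
  have h : N - 5 <= (n - l.+2)%:R.
    by rewrite lerBlDr NE -natrD ler_nat; lia.
  have : p * (N - 5) <= p * (n - l.+2)%:R by apply: ler_wpM2l.
  lra.
have q0 : 0 <= 1 - p + p * (1 / 4) by lra.
rewrite [X in _ * X]mulrCA [X in X <= _]mulrA.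
apply: (@le_trans _ _ ((expR L * (16 * L ^+ 4)) *
    (expR (3 / (10 * 10) * L) * expR (- (57 / 40 * L) + 1)))).
  apply: ler_pM => //.
  - by rewrite mulr_ge0 // exprn_ge0.
  - by rewrite mulr_ge0 ?invr_ge0 ?exprn_ge0 //; lra.
  - by apply: ler_pM; rewrite ?invr_ge0 ?exprn_ge0 //; lra.
rewrite [expR L * _]mulrC -[X in X <= _]mulrA -!expRD.
apply: le_trans L4_le; apply: ler_pM.
- by rewrite mulr_ge0 // exprn_ge0 // L_ge0.
- exact: expR_ge0.
- by rewrite ler_wpM2r ?exprn_ge0 ?L_ge0 //; lra.
- by rewrite ler_expR; lra.
Qed.

(** The tilt [expR (30 * k3)] gains [3 L] per vertex, since [D] exceeds [L / 10000], and its 14th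
    power is [th]. For [#|S| <= N / th] the other factor costs at most [0.51 L] per vertex. Each set
    thus contributes at most [N ^- 2] per vertex, and the sum over nonempty sets is about
    [1 / N]. *)
Lemma estimate_sparse :
  \sum_(S : {set 'I_n} | (0 < #|S| <= 7 * g)%N)
    (expR (30 * k3) ^+ (D * #|S|))^-1 *
      (1 - p + p * expR (30 * k3) ^+ 14) ^+ 'C(#|S|, 2) <= L^-1.
Proof.
have hl := L_big; have ps := p_small; have n0 := N_gt0; have th1 := theta_ge1.
have p0' := p0; have hi' := hi.
have -> : expR (30 * k3) ^+ 14 = th :> R by rewrite thE -expRM_natl; congr expR; lra.
pose x := expR (- (2 * L)).
apply: (@le_trans _ _ (\sum_(S : {set 'I_n} | S != set0) x ^+ #|S|)).
  rewrite [X in X <= _]big_mkcond [X in _ <= X]big_mkcond /=; apply: ler_sum => S _.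
  rewrite -card_gt0; case: ifPn => [/andP[S0 S7]|_]; last first.
    by case: ifP => _ //; rewrite exprn_ge0 // expR_ge0.
  rewrite S0 -expRM_natl -expRN /x -expRM_natl.
  have -> : 1 - p + p * th = 1 + (p * th - p) by ring.
  have u0 : 0 <= p * th - p by rewrite subr_ge0 -{1}[p]mulr1 ler_wpM2l.
  apply: (@le_trans _ _ (expR (- ((D * #|S|)%:R * (30 * k3))) *
     expR ('C(#|S|, 2)%:R * (p * th - p)))).
    rewrite ler_pM2l ?expR_gt0 //; apply: pow_le_expR; lra.
  rewrite -expRD ler_expR natrM.
  set s := (#|S|)%:R : R; have s1 : 1 <= s by rewrite ler1n.
  have sr : s <= N / th.
    have /andP[h _] := g_bounds; apply: le_trans h.
    by rewrite -natrM ler_nat.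
  have hb : ('C(#|S|, 2))%:R <= s * s / 2 := bin2_le R _.
  have e := r_theta; set r := N / th in e sr.
  have h1 : ('C(#|S|, 2))%:R * (p * th - p) <= s * s / 2 * (p * th).
    by apply: ler_pM => //; lra.
  have pt0 : 0 <= p * th by rewrite mulr_ge0 //; lra.
  have h2 : s * s / 2 * (p * th) <= s * (p * N / 2).
    rewrite -e; have : s * (s * (p * th)) <= s * (r * (p * th)).
      by apply: ler_wpM2l; [lra | apply: ler_wpM2r].
    lra.
  have h3 : s * (p * N / 2) <= s * (51 / (10 * 10) * L) by apply: ler_wpM2l; lra.
  have /andP[hD _] := D_bounds.
  have h4 : s * (3 * L) <= s * (D%:R * (30 * k3)) by apply: ler_wpM2l; lra.
  have : 0 <= s * L by rewrite mulr_ge0 ?L_ge0 //; lra.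
  lra.
have E := @sum_subsets_exp R _ [set: 'I_n] x.
rewrite cardsT card_ord in E.
have E2 : \sum_(S : {set 'I_n} | S != set0) x ^+ #|S| = (1 + x) ^+ n - 1.
  rewrite -E [X in _ = X - 1](bigD1 set0) ?sub0set //= cards0 expr0 addrAC subrr add0r.
  by apply: eq_bigl => S; rewrite subsetT.
rewrite E2; have x0 : 0 <= x by apply: expR_ge0.
have nx : n%:R * x = N^-1.
  by rewrite /x -NE N_exp -expRD -expRN; congr expR; ring.
have h1 : (1 + x) ^+ n <= expR (N^-1) by rewrite -nx; apply: pow_le_expR; lra.
have hn := N_big1.
have iN : N^-1 <= (k3 * L)^-1 by rewrite lef_pV2 ?posrE //; lra.
have iL : (k3 * L)^-1 = L^-1 / k3 by field; rewrite gt_eqF //; lra.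
have l1 : L^-1 <= 1 by rewrite invf_le1 //; lra.
have N0 : 0 <= N^-1 by rewrite invr_ge0 ltW.
have := @expR_sub1_le R (N^-1); have -> : 0 <= N^-1 <= 1 / 2 by apply/andP; split; lra.
move=> /(_ isT); lra.
Qed.

Lemma card_pairs_expR (q : pred ({set 'I_n} * {set 'I_n})) (f : {set 'I_n} * {set 'I_n} -> R) (c : R) :
  0 <= c -> (forall AB, q AB -> f AB <= c) -> \sum_(AB | q AB) f AB <= expR (3 / 2 * N) * c.
Proof.
move=> c0 fc; apply: (@le_trans _ _ (\sum_(AB : {set 'I_n} * {set 'I_n}) c)).
  by rewrite [X in X <= _]big_mkcond /=; apply: ler_sum => AB _; case: ifP => // /fc.
rewrite sumr_const card_prod -cardsT -powersetT card_powerset cardsT card_ord -[X in X <= _]mulr_natl.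
apply: ler_wpM2r => //; rewrite natrM natrX pow_expR // -expRD ler_expR -NE.
have n0 := N_gt0; have : N * ln 2 <= N * (3 / 4) by rewrite ler_pM2l // ln2_le.
lra.
Qed.

(** Write [a] for the size of [A]. The tilt costs at most [11/200 * 3/4 * a L], while [B] having at
    least [n / 4] vertices gains [0.95/8 * a L]. The difference beats the [4 ^ n] pairs because
    [a L] is at least [10000 N], [L] being huge compared with [th]. *)
Lemma estimate_dense : 19 / 20 * L <= p * N ->
  \sum_(AB : {set 'I_n} * {set 'I_n} | [&& [disjoint AB.1 & AB.2], (g <= #|AB.1|)%N &
     (n <= 4 * #|AB.2|)%N])
    ((1 / 2) ^+ (w + kd * #|AB.1|))^-1 * (1 - p + p * (1 / 2)) ^+ (#|AB.1| * #|AB.2|) <= L^-1.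
Proof.
move=> lo; have hl := L_big; have ps := p_small; have n0 := N_gt0; have th1 := theta_ge1.
have l0 : 0 < L by lra.
apply: (@le_trans _ _ (expR (3 / 2 * N) * expR (- (3 * N)))); last first.
  by rewrite -expRD; apply: expR_le_invL; have := N_big1; lra.
apply: card_pairs_expR => [|[A B] /= /and3P[_ gA nB]]; first exact: expR_ge0.
set a := (#|A|)%:R : R; set b := (#|B|)%:R : R.
have ga : g%:R <= a by rewrite ler_nat.
have nb : N <= 4 * b by rewrite NE -natrM ler_nat.
have a0 : 0 <= a by rewrite /a ler0n.
apply: (@le_trans _ _ (expR ((w + kd * #|A|)%:R * ln 2) * expR ((#|A| * #|B|)%:R * - (p / 2)))).
  apply: ler_pM; rewrite ?invr_ge0 ?exprn_ge0 //; try lra.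
    by rewrite -exprVn (_ : (1 / 2)^-1 = 2) ?pow_expR //; field.
  rewrite (_ : 1 - p + p * (1 / 2) = 1 + - (p / 2)); last by field.
  by apply: pow_le_expR; lra.
rewrite -expRD ler_expR natrD !natrM -/a -/b.
have /andP[hw _] := w_bounds; have /andP[hk _] := kd_bounds.
have l2 := ln2_le R; have l2' := ln2_ge R.
have gaL : g%:R * L <= a * L by rewrite ler_pM2r.
have ka : kd%:R * a <= 1 / (2 * (10 * 10)) * L * a by apply: ler_wpM2r.
have s1 : w%:R + kd%:R * a <= 11 / (2 * (10 * 10)) * (a * L).
  by move: hw ka gaL; move: (w%:R) (g%:R) (kd%:R) => W G K; lra.
have s0 : 0 <= w%:R + kd%:R * a by rewrite addr_ge0 // mulr_ge0.
have s2 : (w%:R + kd%:R * a) * ln 2 <= (w%:R + kd%:R * a) * (3 / 4) by apply: ler_wpM2l.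
have ab : a * (p * N) <= a * (p * (4 * b)).
  by apply: ler_wpM2l => //; apply: ler_wpM2l.
have alo : a * (19 / 20 * L) <= a * (p * N) by apply: ler_wpM2l.
have gl := g_large; have th0 : 0 < th by lra.
have key : N * (10 * 10 * (10 * 10)) <= a * L.
  have q1 : N * L <= 8 * (th * g%:R) * L by rewrite ler_pM2r.
  have q2 : th * (g%:R * L) <= th * (a * L) by rewrite ler_pM2l.
  have q3 : N * (k3 * (k3 * (k3 * (k3 * th)))) <= N * L by rewrite ler_pM2l.
  have : th * (N * (10 * 10 * (10 * 10))) <= th * (a * L).
    have nt : 0 <= N * th by rewrite mulr_ge0 // ltW.
    move: q1 q2 q3 nt; move: (g%:R) => G; lra.
  by rewrite ler_pM2l.
move: s1 s2 ab alo key n0; clear.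
move: (w%:R) (kd%:R) (ln 2) => W K l2; lra.
Qed.

Lemma estimate_edges : (2 ^+ M)^-1 * (1 + p) ^+ 'C(n, 2) <= L^-1.
Proof.
have hl := L_big; have ps := p_small; have n0 := N_gt0; have hi' := hi; have hn := N_big1.
have p0' := p0.
apply: (@le_trans _ _ (expR (- (M%:R * ln 2)) * expR ('C(n, 2)%:R * p))).
  apply: ler_pM; rewrite ?invr_ge0 ?exprn_ge0 //; try lra.
    by rewrite pow_expR // expRN.
  by apply: pow_le_expR; lra.
rewrite -expRD; apply: expR_le_invL.
have /andP[_ hM] := M_bounds; have l2 := ln2_ge R.
have h1 : M%:R * (3 / 5) <= M%:R * ln 2 :> R by apply: ler_wpM2l.
have h2 : 'C(n, 2)%:R * p <= N * N / 2 * p by apply: ler_wpM2r => //; rewrite NE; apply: bin2_le.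
have h3 : N * (p * N) <= N * (51 / 50 * L) by rewrite ler_pM2l.
have h4 : k3 * L <= N * L by apply: ler_wpM2r; lra.
move: hM h1 h2 h3 h4 hl; move: (M%:R) ('C(n, 2)%:R) (ln 2) => a b c; lra.
Qed.

(* In units of [n L] the exponent is at most
   [27 / 10000 * 8 ln 2 + 1.02 / 256 - 0.95 / 32 < 0]. *)
Lemma estimate_boost : 19 / 20 * L <= p * N ->
  (1 - p) ^+ (n ^ 2 %/ 32 - m) *
    (((1 / (16 * 16)) ^+ m)^-1 * (1 + p * (1 / (16 * 16))) ^+ (2 * 'C(n, 2))) <= L^-1.
Proof.
move=> lo; have hl := L_big; have ps := p_small; have n0 := N_gt0; have hi' := hi.
have hn := N_big1; have p0' := p0; have pl := pL_small.
apply: (@le_trans _ _ (expR ((n ^ 2 %/ 32 - m)%:R * - p) *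
   (expR ((8 * m)%:R * ln 2) * expR ((2 * 'C(n, 2))%:R * (p * (1 / (16 * 16))))))).
  have px0 : 0 <= p * (1 / (16 * 16)) by lra.
  have q0 : 0 <= (1 / (16 * 16))^-1 :> R by rewrite invr_ge0; lra.
  rewrite -!exprVn; apply: ler_pM.
  - by rewrite exprn_ge0 //; lra.
  - by rewrite mulr_ge0 // exprn_ge0 // addr_ge0.
  - by apply: pow_le_expR; lra.
  apply: ler_pM; rewrite ?exprn_ge0 ?addr_ge0 //.
    have -> : (1 / (16 * 16))^-1 = 2 ^+ 8 :> R by rewrite !exprS expr0; field.
    by rewrite -exprM pow_expR.
  by apply: pow_le_expR; rewrite addr_ge0.
rewrite -!expRD; apply: expR_le_invL; rewrite !natrM.
have /andP[hm _] := m_bounds; have l2 := ln2_le R.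
have h0 : N * N / 32 - 1 - m%:R <= (n ^ 2 %/ 32 - m)%:R.
  have d1 : (n ^ 2 <= (n ^ 2 %/ 32 - m + m + 1) * 32)%N.
    apply: leq_trans (ltnW (ltn_ceil (n ^ 2) (isT : (0 < 32)%N))) _.
    by rewrite leq_mul2r /= -addn1 leq_add2r addnC -leq_subLR.
  have : N * N <= ((n ^ 2 %/ 32 - m)%:R + m%:R + 1) * 32.
    by rewrite NE -natrM mulnn -[1]/(1%:R) -!natrD -natrM ler_nat.
  lra.
have h1 : (N * N / 32 - 1 - m%:R) * p <= (n ^ 2 %/ 32 - m)%:R * p by apply: ler_wpM2r.
have h2 : m%:R * ln 2 <= m%:R * (3 / 4) :> R by apply: ler_wpM2l.
have h3 : 'C(n, 2)%:R * p <= N * N / 2 * p by apply: ler_wpM2r => //; rewrite NE; apply: bin2_le.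
have h4 : N * (p * N) <= N * (51 / 50 * L) by rewrite ler_pM2l.
have h5 : N * (19 / 20 * L) <= N * (p * N) by rewrite ler_pM2l.
have h6 : p * m%:R <= p * (27 / (10 * k3) * (N * L)) by apply: ler_wpM2l.
have h7 : N * (p * L) <= N * (1 / k3) by rewrite ler_pM2l.
have h8 : N * k3 <= N * L by rewrite ler_pM2l //; lra.
move: hm h1 h2 h3 h4 h5 h6 h7 h8 hl hn ps.
move: (m%:R) ('C(n, 2)%:R) ((n ^ 2 %/ 32 - m)%:R) (ln 2) => a b c d; lra.
Qed.

Lemma sq_inv_le : ((1 - p) ^+ 2)^-1 - 1 <= L^-1.
Proof.
have hl := L_big; have ps := p_small; have p0' := p0; have pl := pL_small.
have h : ((1 - p) ^+ 2)^-1 <= 1 + 4 * p.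
  rewrite -div1r ler_pdivrMr; last by apply: exprn_gt0; lra.
  have h1 : 0 <= p * (2 - 7 * p) by rewrite mulr_ge0 //; lra.
  have h2 : 0 <= p * (p * p) by rewrite !mulr_ge0.
  have -> : (1 + 4 * p) * (1 - p) ^+ 2 = 1 + p * (2 - 7 * p) + 4 * (p * (p * p)) by ring.
  lra.
have : p * 4 <= L^-1 by rewrite -[L^-1]mul1r ler_pdivlMr; lra.
lra.
Qed.

Lemma pow_lower (c : R) : p * N <= c * L -> 0 <= c <= 2 -> expR (- (c * L) - 1) <= (1 - p) ^+ n.
Proof.
move=> hc /andP[c0 c2].
have hl := L_big; have ps := p_small; have p0' := p0; have pl := pL_small; have n0 := N_gt0.
apply: le_trans (pow_ge_expR n _); last by lra.
rewrite ler_expR -NE.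
have q0 : 0 < 1 - p by lra.
have h : p / (1 - p) <= p + 2 * (p * p).
  rewrite ler_pdivrMr //.
  have : 0 <= p * p * (1 - 2 * p) by rewrite !mulr_ge0 //; lra.
  lra.
have h1 : N * (p / (1 - p)) <= N * (p + 2 * (p * p)) by rewrite ler_pM2l.
have h2 : p * (p * N) <= p * (c * L) by apply: ler_wpM2l.
have h3 : c * (p * L) <= c * (1 / k3) by apply: ler_wpM2l.
lra.
Qed.

(** Any exponential margin in [L] suffices; the rate [1/2000] is half of the one left in
    [min_degree_tail]. *)
Lemma estimate_min_degree k : expR (L / (2 * k3)) <= N * binomial_tail p (n - 2) k ->
  (n%:R * (1 - p) * binomial_tail p (n - 2) k)^-1 + ((1 - p) ^+ 2)^-1 - 1 <= 2 * L^-1.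
Proof.
have hl := L_big; have ps := p_small; have sq := sq_inv_le.
move=> h; rewrite -NE; set q := binomial_tail _ _ _ in h *.
have h2 : L * 2 <= expR (L / (2 * k3)).
  have y0 : 0 <= L / (2 * k3) by lra.
  have := @expR_ge1Dxn R _ 1 y0; rewrite (_ : (2`!)%:R = 2) //; apply: le_trans.
  have -> : (L / (2 * k3)) ^+ 2 = L * (L / (2 * k3 * (2 * k3))) by rewrite !exprS expr0; field.
  have : L * (10 * 10) <= L * (L / (2 * k3 * (2 * k3))) by rewrite ler_pM2l; lra.
  lra.
have h3 : L <= N * (1 - p) * q.
  have : N * q * (1 / 2) <= N * q * (1 - p) by apply: ler_wpM2l; lra.
  lra.
have : (N * (1 - p) * q)^-1 <= L^-1 by rewrite lef_pV2 ?posrE; lra.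
lra.
Qed.

Lemma n_gt : (10 <= n)%N.
Proof.
by rewrite -(ler_nat R) -NE; have := N_big1; have := L_big; lra.
Qed.

Lemma isolated_tail : p * N <= 19 / 20 * L ->
  expR (L / (2 * k3)) <= N * binomial_tail p (n - 2) 0.
Proof.
move=> lo; have hl := L_big; have ps := p_small; have p0' := p0.
rewrite /binomial_tail big_ord1 bin0 expr0 !mul1r subn0.
apply: (@le_trans _ _ (N * (1 - p) ^+ n)); last first.
  rewrite ler_pM2l ?N_gt0 //; apply: ler_wiXn2l; [lra | lra | exact: leq_subr].
apply: (@le_trans _ _ (N * expR (- (19 / 20 * L) - 1))); last first.
  by rewrite ler_pM2l ?N_gt0 //; apply: pow_lower => //; lra.
by rewrite {1}N_exp -expRD ler_expR; lra.
Qed.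

(** Only the top term of the tail is kept. The ratio [(n - 2) * p / kd] is about 190 or more, hence
    at least [2 ^ 7]; with [ln 2 >= 3/5] this gives [7 * 3/5 / 200 = 0.021] against the excess 0.02
    of [p * n / L], leaving a margin [0.001 L]. *)
Lemma min_degree_tail : 19 / 20 * L <= p * N ->
  expR (L / (2 * k3)) <= N * binomial_tail p (n - 2) kd.
Proof.
move=> lo; have hl := L_big; have ps := p_small; have p0' := p0; have n0 := N_gt0.
have /andP[hk1 hk2] := kd_bounds; have hn := N_big1; have n10 := n_gt.
have q0 : 0 <= 1 - p by lra.
have kn : (kd <= n - 2)%N.
  rewrite -(leq_add2r 2) subnK; last by apply: leq_trans n10.
  by rewrite -(ler_nat R) natrD -NE; lra.
have k0 : 0 < kd%:R :> R by lra.
have t1 : 'C(n - 2, kd)%:R * (p ^+ kd * (1 - p) ^+ (n - 2 - kd)) <= binomial_tail p (n - 2) kd.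
  rewrite /binomial_tail (bigD1 ord_max) //= lerDl; apply: sumr_ge0 => j _.
  by rewrite !mulr_ge0 ?exprn_ge0.
have t2 : (2 ^+ 7) ^+ kd <= 'C(n - 2, kd)%:R * p ^+ kd.
  have b := @bin_ge R _ _ kn.
  rewrite -(@ler_pM2l _ (kd%:R ^+ kd)) ?exprn_gt0 // -exprMn.
  apply: (@le_trans _ _ (((n - 2)%:R * p) ^+ kd)).
    have h1 : kd%:R * 2 ^+ 7 <= (n - 2)%:R * p.
      rewrite natrB; last by apply: leq_trans n10.
      by rewrite -NE !exprS expr0; lra.
    apply: lerXn2r => //; rewrite nnegrE.
      by rewrite mulr_ge0 // exprn_ge0.
    by rewrite mulr_ge0.
  by rewrite exprMn mulrA; apply: ler_wpM2r => //; rewrite exprn_ge0.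
have t3 : (1 - p) ^+ n <= (1 - p) ^+ (n - 2 - kd).
  apply: ler_wiXn2l; [lra | lra |]; apply: leq_trans (leq_subr _ _) (leq_subr _ _).
have t4 : expR (- (51 / 50 * L) - 1) <= (1 - p) ^+ n by apply: pow_lower => //; lra.
have t5 : expR ((7 * kd)%:R * ln 2) * expR (- (51 / 50 * L) - 1) <= binomial_tail p (n - 2) kd.
  apply: le_trans t1; rewrite mulrA; apply: ler_pM; rewrite ?expR_ge0 //.
    by apply: le_trans t2; rewrite -exprM pow_expR.
  exact: le_trans t3.
have : N * (expR ((7 * kd)%:R * ln 2) * expR (- (51 / 50 * L) - 1)) <=
   N * binomial_tail p (n - 2) kd by rewrite ler_pM2l.
apply: le_trans; rewrite {1}N_exp -!expRD ler_expR natrM.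
have l2 : kd%:R * (3 / 5) <= kd%:R * ln 2 :> R by rewrite ler_pM2l // ln2_ge.
move: l2 hk2; move: (kd%:R) (ln 2) => a b; lra.
Qed.

(** The ratio [w / M] is about [1 / (160 * th)] at least, so [t], which exceeds [400 * th * N],
    gives a decay of about [exp (- 2.5 N)], while [4 ^ n] is at most [exp (1.5 N)]. *)
Lemma hitting_params : (4 ^ n * (M - w) ^ t < M ^ t)%N.
Proof.
have hl := L_big; have n0 := N_gt0; have th1 := theta_ge1; have hL' := hL; have hn := N_big1.
have /andP[hM1 hM2] := M_bounds; have /andP[hw1 hw2] := w_bounds.
have /andP[ht1 ht2] := t_bounds; have gl := g_large; have /andP[hg _] := g_bounds.
have l0 : 0 < L by lra.
have th0 : 0 < th by lra.
have nl1 : N * 1 <= N * L by rewrite ler_pM2l //; lra.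
have M0 : 0 < M%:R :> R by lra.
have gN : g%:R <= N.
  have e := r_theta; have : N / th <= N by rewrite ler_pdivrMr // ler_peMr // ltW.
  have : 0 <= g%:R :> R by []. lra.
have gNL : g%:R * L <= N * L by rewrite ler_pM2r.
have wM : (w <= M)%N by rewrite -(ler_nat R); lra.
rewrite -(ltr_nat R) natrM !natrX natrB //.
have e1 : M%:R - w%:R = M%:R * (1 + - (w%:R / M%:R)) :> R by field; rewrite gt_eqF.
have u0 : 0 <= 1 + - (w%:R / M%:R) :> R.
  by rewrite subr_ge0 ler_pdivrMr // mul1r ler_nat.
rewrite e1 exprMn mulrCA gtr_pMr ?exprn_gt0 //.
apply: (@le_lt_trans _ _ (expR ((2 * n)%:R * ln 2) * expR (t%:R * - (w%:R / M%:R)))).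
  apply: ler_pM; rewrite ?exprn_ge0 //.
    have -> : 4 = 2 ^+ 2 :> R by rewrite !exprS expr0; lra.
    by rewrite -exprM pow_expR.
  exact: pow_le_expR.
rewrite -expRD expR_lt1 natrM -NE.
have l2 : N * ln 2 <= N * (3 / 4) by rewrite ler_pM2l // ln2_le.
suff : 3 / 2 * N < t%:R * (w%:R / M%:R) by lra.
rewrite mulrA ltr_pdivlMr //.
have a1 : 3 / 2 * N * M%:R <= 3 / 2 * N * (N * L) by rewrite ler_pM2l //; lra.
have w0 : 0 <= 1 / 20 * (g%:R * L) - 1.
  have g1 : 10 * 10 <= g%:R :> R.
    have h1 : th * (k3 * k3) <= 8 * (th * g%:R).
      apply: le_trans gl; apply: le_trans hn; have : 0 <= L by lra. lra.
    have : th * (10 * 10) <= th * g%:R by lra.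
    by rewrite ler_pM2l.
  have : (10 * 10) * L <= g%:R * L by rewrite ler_pM2r.
  lra.
have a2 : (4 * (10 * 10) * (th * N)) * (1 / 20 * (g%:R * L) - 1) <= t%:R * w%:R.
  apply: ler_pM => //; try lra.
  by rewrite mulr_ge0 ?mulr_ge0 // ltW.
have a3 : N * L * N <= N * L * (8 * (th * g%:R)) by rewrite ler_pM2l // mulr_gt0.
have a4 : N * (k3 * th) <= N * L by rewrite ler_pM2l //; lra.
have a5 : N * L * 1 <= N * L * N by rewrite ler_pM2l ?mulr_gt0 //; lra.
have a6 : 0 < N * L * N by rewrite !mulr_gt0.
move: a1 a2 a3 a4 a5 a6; move: (M%:R) (t%:R) (w%:R) (g%:R) => a b c d.
lra.
Qed.

Lemma other_params :
  [/\ (3 < n)%N, (2 <= D)%N, (D + kd <= k1)%N, (4 * g <= n)%N &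
      (n * kd./2 + n * D + t + n <= m)%N].
Proof.
have hl := L_big; have n0 := N_gt0; have th1 := theta_ge1; have hL' := hL; have hn := N_big1.
have /andP[hk1 hk2] := kd_bounds; have /andP[hD1 hD2] := D_bounds.
have /andP[ht1 ht2] := t_bounds; have /andP[hg _] := g_bounds.
have l0 : 0 < L by lra.
have th0 : 0 < th by lra.
split.
- by apply: leq_trans n_gt.
- by rewrite -(ler_nat R); lra.
- by rewrite /k1 truncn_ge_nat; [rewrite natrD|]; lra.
- rewrite -(ler_nat R) natrM -NE.
  have e := r_theta; have : N / th <= N by rewrite ler_pdivrMr // ler_peMr // ltW.
  have : 0 <= g%:R :> R by []. lra.
- rewrite /m truncn_ge_nat; last first.
    by rewrite mulr_ge0 ?mulr_ge0 ?(ltW n0) ?(ltW l0) //; lra.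
  rewrite !natrD !natrM -NE.
  have hh : kd./2%:R * 2 <= kd%:R :> R.
    by rewrite -natrM ler_nat muln2 -[X in (_ <= X)%N]odd_double_half leq_addl.
  have b1 : N * (kd./2%:R * 2) <= N * (1 / (2 * (10 * 10)) * L) by rewrite ler_pM2l //; lra.
  have b2 : N * D%:R <= N * (L / (10 * k3) + 1) by rewrite ler_pM2l.
  have b3 : N * (k3 * (k3 * (k3 * (k3 * th)))) <= N * L by rewrite ler_pM2l.
  have b4 : N * 1 <= N * th by rewrite ler_pM2l.
  have b5 : 1 <= N by lra.
  move: b1 b2 b3 b4 b5 ht2; move: (kd./2%:R) (D%:R) (t%:R) => a b c; lra.
Qed.

(** The 10 is made up of 2 from the second moment, 4 from the path lengths, and 1 for each of the
    other four atypical events. *)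
Lemma packing_failure_bound :
  gnp_prob p (fun E : {set {set 'I_n}} =>
    ~~ edge_disjoint_hamilton_cycles E (min_degree E)./2) <= 10 * L^-1.
Proof.
have hl := L_big; have ps := p_small; have p0' := p0; have li := L_inv_gt0.
have p01 : 0 <= p <= 1 by apply/andP; split; lra.
have n1 : (1 < n)%N by apply: leq_trans n_gt.
have p1 : p < 1 by lra.
have tail_gt0 k : expR (L / (2 * k3)) <= N * binomial_tail p (n - 2) k ->
    0 < binomial_tail p (n - 2) k.
  by move=> h; rewrite -(pmulr_rgt0 _ N_gt0); apply: lt_le_trans h; apply: expR_gt0.
have [lo|/ltW lo] := leP (p * N) (19 / 20 * L).
  have it := isolated_tail lo.
  apply: (@le_trans _ _ (gnp_prob p (fun E : {set {set 'I_n}} => (0 < min_degree E)%N))).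
    apply: gnp_prob_le => // E EV; apply: contraR; rewrite -eqn0Ngt => /eqP->.
    exact: edge_disjoint_hamilton_cycles0.
  apply: le_trans (gnp_min_degree_gt p01 n1 p1 (tail_gt0 _ it)) _.
  by apply: le_trans (estimate_min_degree it) _; lra.
have mt := min_degree_tail lo.
have [n3 D2 Dk g4 mB] := other_params.
apply: (@le_trans _ _ (gnp_prob p (fun E : {set {set 'I_n}} =>
   (kd < min_degree E)%N || ~~ `[< typical E kd k1 D g w M m >]))).
  apply: gnp_prob_le => // E EV; apply: contraR; rewrite negb_or negbK -leqNgt.
  case/andP=> hkd /asboolP typ.
  by apply: (@hamilton_packing _ E kd k1 D g w M m t); rewrite ?card_ord ?hitting_params.
apply: le_trans (gnp_probU p01 _ _) _.
have B0 := le_trans (gnp_min_degree_gt p01 n1 p1 (tail_gt0 _ mt)) (estimate_min_degree mt).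
have x4 : 0 < (1 / 4 : R) <= 1 by lra.
have x2 : 0 < (1 / 2 : R) <= 1 by lra.
have x256 : 0 < (1 / (16 * 16) : R) <= 1 by lra.
have y1 : 1 <= expR (30 * k3) :> R by apply: le_trans (expR_ge1Dx _); lra.
have B1 : \sum_(l < 4) gnp_prob p (fun E : {set {set 'I_n}} => close_pair E k1 l.+1) <= 4 * L^-1.
  apply: (@le_trans _ _ (\sum_(l < 4) L^-1)); last by rewrite sumr_const card_ord mulr_natl.
  apply: ler_sum => l _; apply: (le_trans (@gnp_close_pair R n p p01 k1 l.+1 _ x4 isT)).
  exact: estimate_close_pair.
have B2 := le_trans (@gnp_not_sparse R n p p01 D (7 * g) _ y1) estimate_sparse.
have B3 := le_trans (@gnp_not_dense R n p p01 kd g w _ x2) (estimate_dense lo).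
have B4 := le_trans (@gnp_many_edges R n p p01 M) estimate_edges.
have B5 := le_trans (@gnp_no_booster R n p p01 m _ x256) (estimate_boost lo).
have B := @gnp_atypical R n p p01 kd k1 D g w M m.
have S : gnp_prob p (fun E : {set {set 'I_n}} => ~~ `[< typical E kd k1 D g w M m >]) <=
    4 * L^-1 + L^-1 + L^-1 + L^-1 + L^-1.
  apply: le_trans B _; by do 4 (apply: lerD => //).
apply: le_trans (lerD B0 S) _; lra.
Qed.

End Estimates.

Local Open Scope classical_set_scope.

Theorem theorem4 (R : realType) (p : nat -> R)
    (hp01 : forall n : nat, 0 <= p n <= 1)
    (hp : forall n : nat, (0 < n)%N ->
       p n <= (102%:R / 100%:R) * ln (n%:R : R) / n%:R) :
  (fun n : nat =>
     gnp_prob (p n) (fun E : {set {set 'I_n}} =>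
       edge_disjoint_hamilton_cycles E (min_degree E)./2)) @ \oo --> (1 : R).
Proof.
apply/cvgrPdist_le => e e0.
pose th : R := expR (42 * (10 * (10 * 10 * 10))).
(* The first term makes the failure bound [10 / L] at most [e]; the second is the largeness of [L]
   assumed by the estimates. *)
pose K := Num.max (10 / e)
  (10 * 10 * 10 * (10 * 10 * 10 * (10 * 10 * 10 * (10 * 10 * 10 * th)))).
near=> n.
have n0 : (0 < n)%N by near: n; exact: nbhs_infty_gt.
have nR : 0 < n%:R :> R by rewrite ltr0n.
have KL : K <= ln (n%:R : R).
  rewrite -ler_expR lnK ?posrE //; near: n; exact: nbhs_infty_ger.
move: KL; rewrite ge_max => /andP[eL thL].
case/andP: (hp01 n) => p0 _.
have pN : p n * n%:R <= 51 / 50 * ln (n%:R : R).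
  by rewrite -ler_pdivlMr //; apply: le_trans (hp n n0) _; rewrite ler_pM2r ?invr_gt0 //; lra.
have L0 : 0 < ln (n%:R : R) by apply: lt_le_trans eL; rewrite divr_gt0.
have bd := packing_failure_bound erefl erefl erefl thL p0 pN.
rewrite gnp_prob_compl // opprB addrCA subrr addr0 ger0_norm ?gnp_prob_ge0 //.
apply: le_trans bd _; rewrite ler_pdivrMr // mulrC.
by move: eL; rewrite ler_pdivrMr.
Unshelve. all: by end_near. Qed.
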